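(* For given $m,n,p\in\mathbb{N}$, $\mu<\sqrt{mn}/(r\sqrt{s})$, $\Delta\in(0,1)$, and a random linear transform $\mathcal{A}:\mathbb{R}^{m\times n}\to\mathbb{R}^p$ that is nearly isometrically distributed, there exist constants $c_0,c_1>0$, depending only on $\Delta$, such that the restricted isometry constant satisfies $\Delta_{r,s,\mu}(\mathcal{A})\le\Delta$ with probability at least $1-\exp(-c_1 p)$, provided $$p > c_0\left(r(m+n-r)+s\right)\log\left(\left(1-\mu^2\frac{r^2 s}{mn}\right)^{-1/2}\frac{mn}{s}\right).$$
   Context: $\|\cdot\|_F$ is the Frobenius norm; $\|S\|_0$ is the number of non-zero entries of $S$; $\|\mathcal{A}\|$ is the operator norm of $\mathcal{A}$ from $(\mathbb{R}^{m\times n},\|\cdot\|_F)$ to $(\mathbb{R}^p,\|\cdot\|_2)$. For $\mu\in[1,\sqrt{mn}/r]$, $\mathrm{LS}_{m,n}(r,s,\mu)$ is the set of all matrices $L+S\in\mathbb{R}^{m\times n}$ such that $\mathrm{rank}(L)\le r$, $\|S\|_0\le s$, $\max_{i\in[m]}\|U^T e_i\|_2\le\sqrt{\mu r/m}$ and $\max_{i\in[n]}\|V^T f_i\|_2\le\sqrt{\mu r/n}$, where $U\in\mathbb{R}^{m\times r}$, $V\in\mathbb{R}^{n\times r}$ are the first $r$ left and right singular vectors of $L$, and $e_i\in\mathbb{R}^m$, $f_i\in\mathbb{R}^n$ are canonical basis vectors. Restricted isometry constant (RIC): for a linear map $\mathcal{A}:\mathbb{R}^{m\times n}\to\mathbb{R}^p$,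 $\Delta_{r,s,\mu}(\mathcal{A})>0$ is the smallest constant such that $(1-\Delta_{r,s,\mu}(\mathcal{A}))\|X\|_F^2\le\|\mathcal{A}(X)\|_2^2\le(1+\Delta_{r,s,\mu}(\mathcal{A}))\|X\|_F^2$ for all $X\in\mathrm{LS}_{m,n}(r,s,\mu)$. Nearly isometrically distributed: a random variable $\mathcal{A}$ with values in linear maps $\mathbb{R}^{m\times n}\to\mathbb{R}^p$ is nearly isometrically distributed if (i) for all $X\in\mathbb{R}^{m\times n}$, $\mathbb{E}[\|\mathcal{A}(X)\|_2^2]=\|X\|_F^2$; (ii) for all $X\in\mathbb{R}^{m\times n}$ and all $\varepsilon\in(0,1)$, $\Pr\left(\left|\|\mathcal{A}(X)\|_2^2-\|X\|_F^2\right|\ge\varepsilon\|X\|_F^2\right)\le 2\exp\left(-\frac p2(\varepsilon^2/2-\varepsilon^3/3)\right)$; (iii) there is a constant $\gamma>0$ such that for all $t>0$, $\Pr\left(\|\mathcal{A}\|\ge 1+\sqrt{mn/p}+t\right)\le\exp(-\gamma p t^2)$. *)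

(* Defs.v *)
From HB Require Import structures.
From mathcomp Require Import all_boot all_order all_algebra.
From mathcomp Require Import all_classical all_reals all_analysis.

Set Implicit Arguments.
Unset Strict Implicit.
Unset Printing Implicit Defensive.

Import Order.TTheory GRing.Theory Num.Theory.

Local Open Scope classical_set_scope.
Local Open Scope ring_scope.

(* The library's norm on matrices is the max norm, hence this definition.
   On column vectors it is the Euclidean norm. *)
Definition fnorm (R : realType) (m n : nat) (X : 'M[R]_(m, n)) : R :=
  Num.sqrt (\sum_(i < m) \sum_(j < n) X i j ^+ 2).

Definition nnz (R : realType) (m n : nat) (X : 'M[R]_(m, n)) : nat :=
  #|[set ij : 'I_m * 'I_n | X ij.1 ij.2 != 0]%SET|.

Definition opnorm (R : realType) (m n p : nat)
    (A : {linear 'M[R]_(m, n) -> 'cV[R]_p}) : R :=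
  sup [set fnorm (A X) | X in [set X : 'M[R]_(m, n) | fnorm X <= 1]].

(* Only the values of sigma below minn m n enter the decomposition. *)
Definition is_svd (R : realType) (m n : nat) (L : 'M[R]_(m, n))
    (W : 'M[R]_m) (sigma : nat -> R) (Z : 'M[R]_n) : Prop :=
  [/\ W^T *m W = 1%:M, Z^T *m Z = 1%:M,
      (forall k, 0 <= sigma k),
      (forall k l, (k <= l)%N -> sigma l <= sigma k)
    & L = W *m (\matrix_(i < m, j < n)
                  (if (i : nat) == j then sigma i else 0)) *m Z^T].

(* A singular value decomposition is not unique: U and V are the first r
   singular vectors in some decomposition of L. *)
Definition first_singular_vectors (R : realType) (m n r : nat)
    (L : 'M[R]_(m, n)) (U : 'M[R]_(m, r)) (V : 'M[R]_(n, r)) : Prop :=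
  exists (rm : (r <= m)%N) (rn : (r <= n)%N)
         (W : 'M[R]_m) (sigma : nat -> R) (Z : 'M[R]_n),
    [/\ is_svd L W sigma Z,
        U = colsub (widen_ord rm) W
      & V = colsub (widen_ord rn) Z].

Definition incoherent (R : realType) (m n r : nat) (mu : R)
    (L : 'M[R]_(m, n)) : Prop :=
  exists (U : 'M[R]_(m, r)) (V : 'M[R]_(n, r)),
    [/\ first_singular_vectors L U V,
        (forall i : 'I_m, fnorm (U^T *m (delta_mx i 0 : 'cV[R]_m))
                            <= Num.sqrt (mu * r%:R / m%:R))
      & (forall i : 'I_n, fnorm (V^T *m (delta_mx i 0 : 'cV[R]_n))
                            <= Num.sqrt (mu * r%:R / n%:R))].

Definition LS (R : realType) (m n r s : nat) (mu : R) : set 'M[R]_(m, n) :=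
  [set X | exists L S : 'M[R]_(m, n),
     [/\ X = L + S, (\rank L <= r)%N, (nnz S <= s)%N & incoherent r mu L]].

(* For linear A the set below is nonempty and, up to its lower endpoint 0,
   closed, so that inf is the smallest constant; it is 0 when A is isometric
   on LS. *)
Definition ric (R : realType) (m n p r s : nat) (mu : R)
    (A : {linear 'M[R]_(m, n) -> 'cV[R]_p}) : R :=
  inf [set delta : R | 0 < delta /\
         forall X, LS r s mu X ->
           (1 - delta) * fnorm X ^+ 2 <= fnorm (A X) ^+ 2
             <= (1 + delta) * fnorm X ^+ 2].

(* Measurability of all X |-> (A w X)_i is Borel measurability of w |-> A w
   for the finite-dimensional space of linear maps. *)
Definition random_linear_map (d : measure_display) (T : measurableType d)
    (R : realType) (m n p : nat)
    (A : T -> {linear 'M[R]_(m, n) -> 'cV[R]_p}) : Prop :=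
  forall (X : 'M[R]_(m, n)) (i : 'I_p),
    measurable_fun [set: T] (fun w => A w X i 0).

(* X = 0 is excluded from the concentration bound: for X = 0 the event
   `|0 - 0| >= eps * 0 is certain, whereas the bound is below 1 for large p. *)
Definition nearly_isometric (d : measure_display) (T : measurableType d)
    (R : realType) (P : probability T R) (m n p : nat)
    (A : T -> {linear 'M[R]_(m, n) -> 'cV[R]_p}) : Prop :=
  [/\ (forall X : 'M[R]_(m, n),
         ('E_P[fun w => (fnorm (A w X) ^+ 2)%R])%E = (fnorm X ^+ 2)%:E),
      (forall (X : 'M[R]_(m, n)) (eps : R), X != 0 -> 0 < eps < 1 ->
         (P [set w | (eps * fnorm X ^+ 2
                       <= `|fnorm (A w X) ^+ 2 - fnorm X ^+ 2|)%R]
          <= (2 * expR (- (p%:R / 2 * (eps ^+ 2 / 2 - eps ^+ 3 / 3))))%:E)%E)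
    & (exists2 gamma : R, 0 < gamma & forall t : R, 0 < t ->
         (P [set w | (1 + Num.sqrt (m%:R * n%:R / p%:R) + t
                       <= opnorm (A w))%R]
          <= (expR (- (gamma * p%:R * t ^+ 2)))%:E)%E)].

(* Main.v *)
(* The set LS is handled through its two components. Incoherence of L bounds
   its entries, which gives <L,S>^2 <= g |L|^2 |S|^2 with
   g = mu^2 r^2 s / (mn) < 1, hence |L|, |S| <= tau |L+S| with
   tau = (1-g)^(-1/2). So it is enough to control A on L' + S', with L' and S'
   in finite nets of the rank-r and of the s-sparse matrices of norm <= tau.
   Writing L = U M with U a partial isometry, a net of grid points for (U, M)
   and for S has cardinality exp(O(r(m+n-r)+s) log(tau mn/s)); the factor
   sqrt r in the radius of the net for U is harmless because r^2 <= mn/s.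
   The error of approximation is a sum of three matrices of rank <= r or
   sparsity <= s, on which A is bounded by a self-improving estimate over the
   same net. The event that the RIC is <= Delta is measurable because LS has a
   countable dense subset. *)
Require Import Defs.
From HB Require Import structures.
From mathcomp Require Import all_boot all_order all_algebra.
From mathcomp Require Import all_classical all_reals all_analysis.
From mathcomp Require Import ring lra.

Set Implicit Arguments.
Unset Strict Implicit.
Unset Printing Implicit Defensive.

Import Order.TTheory GRing.Theory Num.Theory.

Local Open Scope classical_set_scope.
Local Open Scope ring_scope.

(** * Cauchy-Schwarz and the Frobenius norm *)

Lemma cauchy_schwarz_sum (R : rcfType) (I : finType) (P : pred I)
    (f g : I -> R) :
  \sum_(i | P i) f i * g i
  <= Num.sqrt (\sum_(i | P i) f i ^+ 2) * Num.sqrt (\sum_(i | P i) g i ^+ 2).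
Proof.
set F := \sum_(i | P i) f i ^+ 2; set G := \sum_(i | P i) g i ^+ 2.
have F0 : 0 <= F by apply: sumr_ge0 => i _; exact: sqr_ge0.
have G0 : 0 <= G by apply: sumr_ge0 => i _; exact: sqr_ge0.
set T := \sum_(i | P i) f i * g i.
have quad (a b : R) : 0 <= a ^+ 2 * F - 2 * a * b * T + b ^+ 2 * G.
  have -> : a ^+ 2 * F - 2 * a * b * T + b ^+ 2 * G
      = \sum_(i | P i) (a * f i - b * g i) ^+ 2.
    rewrite /F /T /G !mulr_sumr -sumrB -big_split /=.
    by apply: eq_bigr => i _; ring.
  by apply: sumr_ge0 => i _; exact: sqr_ge0.
have [F1 G1] := (sqr_sqrtr F0, sqr_sqrtr G0).
move: (sqrtr_ge0 F) (sqrtr_ge0 G) F1 G1.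
move: (Num.sqrt F) (Num.sqrt G) => a b a0 b0 aF bG.
rewrite leNgt; apply/negP => abT.
have T0 : 0 < T by apply: le_lt_trans abT; exact: mulr_ge0.
have [a1|an0] := eqVneq a 0.
  (* If one norm vanishes, the form is affine in the corresponding coefficient, and the chosen point
     makes it negative: here its value is -2(G + 1) + G. When both norms are nonzero, the point (b,
     a) below gives the contradiction. *)
  have := quad ((G + 1) / T) 1; rewrite -aF a1.
  have -> : 2 * ((G + 1) / T) * 1 * T = 2 * (G + 1) by field; exact: lt0r_neq0.
  by nra.
have [b1|bn0] := eqVneq b 0.
  have := quad 1 ((F + 1) / T); rewrite -bG b1.
  have -> : 2 * 1 * ((F + 1) / T) * T = 2 * (F + 1) by field; exact: lt0r_neq0.
  by nra.
have ab0 : 0 < a * b by rewrite mulr_gt0 ?lt0r ?an0 ?bn0.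
have := quad b a; rewrite -aF -bG.
have -> : b ^+ 2 * a ^+ 2 - 2 * b * a * T + a ^+ 2 * b ^+ 2
          = 2 * (a * b) * (a * b - T) by ring.
have abT' : a * b - T < 0 by rewrite subr_lt0.
by apply/negP; rewrite -ltNge pmulr_rlt0 // mulr_gt0.
Qed.

Lemma fnormE (R : realType) (m n : nat) (X : 'M[R]_(m, n)) :
  fnorm X ^+ 2 = \sum_(p : 'I_m * 'I_n) X p.1 p.2 ^+ 2.
Proof.
rewrite sqr_sqrtr; first by rewrite pair_bigA.
by apply: sumr_ge0 => i _; apply: sumr_ge0 => j _; exact: sqr_ge0.
Qed.

Lemma fnorm_ge0 (R : realType) (m n : nat) (X : 'M[R]_(m, n)) : 0 <= fnorm X.
Proof. exact: sqrtr_ge0. Qed.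

Lemma fnorm_sqrt (R : realType) (m n : nat) (X : 'M[R]_(m, n)) :
  fnorm X = Num.sqrt (\sum_(p : 'I_m * 'I_n) X p.1 p.2 ^+ 2).
Proof. by rewrite -fnormE sqrtr_sqr ger0_norm ?fnorm_ge0. Qed.

Lemma fnorm_le_sqr (R : realType) (m n m' n' : nat) (X : 'M[R]_(m, n))
    (Y : 'M[R]_(m', n')) :
  (fnorm X <= fnorm Y) = (fnorm X ^+ 2 <= fnorm Y ^+ 2).
Proof. by rewrite ler_sqr // nnegrE fnorm_ge0. Qed.

Lemma fnorm0 (R : realType) (m n : nat) : fnorm (0 : 'M[R]_(m, n)) = 0.
Proof.
by rewrite fnorm_sqrt big1 ?sqrtr0 // => p _; rewrite mxE expr0n.
Qed.

Lemma fnorm_eq0 (R : realType) (m n : nat) (X : 'M[R]_(m, n)) :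
  (fnorm X == 0) = (X == 0).
Proof.
apply/idP/idP => [/eqP X0|/eqP ->]; last by rewrite fnorm0.
have /eqP := fnormE X; rewrite X0 expr0n /= eq_sym psumr_eq0; last first.
  by move=> p _; exact: sqr_ge0.
move=> /allP h; apply/eqP/matrixP => i j; rewrite mxE.
by have /= := h (i, j) (mem_index_enum _); rewrite sqrf_eq0 => /eqP.
Qed.

Lemma fnormZ (R : realType) (m n : nat) (a : R) (X : 'M[R]_(m, n)) :
  fnorm (a *: X) = `|a| * fnorm X.
Proof.
rewrite !fnorm_sqrt -sqrtr_sqr -sqrtrM ?sqr_ge0 // mulr_sumr.
by congr Num.sqrt; apply: eq_bigr => p _; rewrite mxE exprMn.
Qed.

Lemma fnormN (R : realType) (m n : nat) (X : 'M[R]_(m, n)) :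
  fnorm (- X) = fnorm X.
Proof. by rewrite -scaleN1r fnormZ normrN1 mul1r. Qed.

Lemma fnorm_unit (R : realType) (m n : nat) (X : 'M[R]_(m, n)) :
  X != 0 -> fnorm ((fnorm X)^-1 *: X) = 1.
Proof.
rewrite -fnorm_eq0 => X0.
by rewrite fnormZ normfV ger0_norm ?fnorm_ge0 // mulVf.
Qed.

Lemma fnormD_sqr (R : realType) (m n : nat) (X Y : 'M[R]_(m, n)) :
  fnorm (X + Y) ^+ 2 = fnorm X ^+ 2 + fnorm Y ^+ 2
    + 2 * \sum_(p : 'I_m * 'I_n) X p.1 p.2 * Y p.1 p.2.
Proof.
rewrite !fnormE mulr_sumr -!big_split /=; apply: eq_bigr => p _.
by rewrite mxE; ring.
Qed.

Lemma ler_fnormD (R : realType) (m n : nat) (X Y : 'M[R]_(m, n)) :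
  fnorm (X + Y) <= fnorm X + fnorm Y.
Proof.
rewrite -ler_sqr ?nnegrE ?addr_ge0 ?fnorm_ge0 // fnormD_sqr sqrrD.
have := cauchy_schwarz_sum xpredT (fun p : 'I_m * 'I_n => X p.1 p.2)
  (fun p => Y p.1 p.2).
by rewrite -!fnorm_sqrt; lra.
Qed.

Lemma ler_fnormB (R : realType) (m n : nat) (X Y : 'M[R]_(m, n)) :
  fnorm (X - Y) <= fnorm X + fnorm Y.
Proof. by rewrite -(fnormN Y) ler_fnormD. Qed.

Lemma ler_fnorm_sum (R : realType) (m n : nat) (I : finType)
    (F : I -> 'M[R]_(m, n)) :
  fnorm (\sum_i F i) <= \sum_i fnorm (F i).
Proof.
apply: (big_ind2 (fun (X : 'M[R]_(m, n)) y => fnorm X <= y)) => [||//].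
  by rewrite fnorm0.
by move=> X x Y y hX hY; apply: le_trans (ler_fnormD _ _) (lerD hX hY).
Qed.

Lemma fnorm_tr (R : realType) (m n : nat) (X : 'M[R]_(m, n)) :
  fnorm X^T = fnorm X.
Proof.
rewrite /fnorm exchange_big; congr Num.sqrt.
by apply: eq_bigr => i _; apply: eq_bigr => j _; rewrite mxE.
Qed.

Lemma fnorm_trace (R : realType) (m n : nat) (X : 'M[R]_(m, n)) :
  fnorm X ^+ 2 = \tr (X^T *m X).
Proof.
rewrite -fnorm_tr sqr_sqrtr; last first.
  by apply: sumr_ge0 => i _; apply: sumr_ge0 => j _; exact: sqr_ge0.
apply: eq_bigr => i _; rewrite mxE; apply: eq_bigr => j _.
by rewrite !mxE expr2.
Qed.

Lemma cauchy_schwarz_sqr (R : rcfType) (I : finType) (P : pred I)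
    (f g : I -> R) :
  (\sum_(i | P i) f i * g i) ^+ 2
  <= (\sum_(i | P i) f i ^+ 2) * (\sum_(i | P i) g i ^+ 2).
Proof.
have s0 (h : I -> R) : 0 <= \sum_(i | P i) h i ^+ 2.
  by apply: sumr_ge0 => l _; exact: sqr_ge0.
have h1 := cauchy_schwarz_sum P f g.
have := cauchy_schwarz_sum P (fun i => - f i) g.
rewrite (eq_bigr (fun i => - (f i * g i))); last by move=> i _; rewrite mulNr.
rewrite sumrN [X in Num.sqrt X * _](eq_bigr (fun i => f i ^+ 2)); last first.
  by move=> i _; rewrite sqrrN.
move=> h2.
rewrite -(sqr_sqrtr (s0 f)) -(sqr_sqrtr (s0 g)) -exprMn.
rewrite -real_normK ?num_real //.
rewrite ler_sqr ?nnegrE ?mulr_ge0 ?sqrtr_ge0 // ler_norml.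
by apply/andP; split => //; rewrite lerNl.
Qed.

Lemma fnorm_mulmx (R : realType) (m k n : nat) (X : 'M[R]_(m, k))
    (Y : 'M[R]_(k, n)) :
  fnorm (X *m Y) <= fnorm X * fnorm Y.
Proof.
rewrite -(fnorm_tr Y) /fnorm -sqrtrM; last first.
  by apply: sumr_ge0 => i _; apply: sumr_ge0 => j _; exact: sqr_ge0.
apply: ler_wsqrtr; rewrite mulr_suml; apply: ler_sum => i _.
rewrite mulr_sumr; apply: ler_sum => j _.
rewrite mxE; apply: le_trans (cauchy_schwarz_sqr _ _ _) _.
have -> : \sum_l Y^T j l ^+ 2 = \sum_l Y l j ^+ 2.
  by apply: eq_bigr => l _; rewrite mxE.
exact: lexx.
Qed.

Lemma ler_entry_fnorm (R : realType) (m n : nat) (X : 'M[R]_(m, n)) i j :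
  `|X i j| <= fnorm X.
Proof.
rewrite -ler_sqr ?nnegrE ?fnorm_ge0 // real_normK ?num_real // fnormE.
rewrite (bigD1 (i, j)) //= lerDl; apply: sumr_ge0 => p _; exact: sqr_ge0.
Qed.

(** * Partial isometries and factorization of low-rank matrices *)

Lemma fnorm_partial_isometry (R : realType) (m k n : nat) (U : 'M[R]_(m, k))
    (Y : 'M[R]_(k, n)) :
  U *m U^T *m U = U -> fnorm (U *m Y) <= fnorm Y.
Proof.
(* [E] is the orthogonal projector onto the kernel of [U]; the loss |Y|^2 - |UY|^2 is exactly
   |EY|^2. *)
move=> hU; pose G := U^T *m U; pose E := 1%:M - G.
have GG : G *m G = G by rewrite /G mulmxA -(mulmxA U^T) -mulmxA hU.
have ET : E^T = E by rewrite /E linearB /= trmx1 /G trmx_mul trmxK.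
have EE : E *m E = E.
  by rewrite /E mulmxBl mul1mx mulmxBr mulmx1 GG subrr subr0.
rewrite fnorm_le_sqr -subr_ge0.
suff -> : fnorm Y ^+ 2 - fnorm (U *m Y) ^+ 2 = fnorm (E *m Y) ^+ 2.
  exact: sqr_ge0.
rewrite !fnorm_trace !trmx_mul ET -!mulmxA (mulmxA E E) EE /E.
by rewrite mulmxBl mul1mx mulmxBr linearB /= /G !mulmxA.
Qed.

(** Gram-Schmidt, one column at a time. A column already in the span of the others contributes a
    zero column to [U], so [U] keeps exactly [r] columns whatever the rank of [B]; this is why a
    partial isometry is asked for and not orthonormal columns. *)
Lemma exists_partial_isometry (R : realType) (m r : nat) (B : 'M[R]_(m, r)) :
  exists U : 'M[R]_(m, r), U *m U^T *m U = U /\ U *m U^T *m B = B.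
Proof.
elim: r B => [|r IH] B.
  by exists 0; split; apply/matrixP => i [].
rewrite -[r.+1]/(1 + r)%N in B *.
rewrite -(hsubmxK B); move: (lsubmx B) (rsubmx B) => b B1.
have [U [UUU UB]] := IH B1.
pose P := U *m U^T; pose v := b - P *m b; pose u := (fnorm v)^-1 *: v.
have UTv : U^T *m v = 0.
  rewrite /v mulmxBr /P !mulmxA.
  have -> : U^T *m U *m U^T = U^T.
    by rewrite -[RHS]trmxK -[in RHS]UUU !trmx_mul !trmxK mulmxA.
  by rewrite subrr.
have UTu : U^T *m u = 0 by rewrite /u -scalemxAr UTv scaler0.
have uTU : u^T *m U = 0 by rewrite -[LHS]trmxK trmx_mul trmxK UTu trmx0.
have vv : v^T *m v = (fnorm v ^+ 2)%:M.
  by rewrite fnorm_trace trace_mx11 -mx11_scalar.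
have uuv : u *m u^T *m v = v.
  have [->|v0] := eqVneq v 0; first by rewrite mulmx0.
  rewrite /u linearZ /= -scalemxAr -!scalemxAl scalerA -mulmxA vv.
  rewrite mul_mx_scalar scalerA -expr2 exprVn mulVf ?scale1r //.
  by rewrite expf_neq0 // fnorm_eq0.
have uuu : u *m u^T *m u = u.
  by rewrite {3}/u -scalemxAr uuv.
exists (row_mx u U).
rewrite tr_row_mx mul_row_col -/P; split; rewrite mul_mx_row !mulmxDl.
  rewrite uuu -!(mulmxA _ _ u) UTu mulmx0 addr0.
  by rewrite -(mulmxA u) uTU mulmx0 add0r UUU.
congr row_mx; last first.
  by rewrite -{1}UB !mulmxA -(mulmxA u u^T U) uTU mulmx0 !mul0mx add0r.
have bE : b = v + P *m b by rewrite /v subrK.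
have uuP : u *m u^T *m (P *m b) = 0.
  by rewrite /P !mulmxA -(mulmxA u u^T U) uTU mulmx0 !mul0mx.
by rewrite {1}bE mulmxDr uuv uuP addr0 -bE.
Qed.

(** Take M = U^T X, where U U^T fixes the column space of X. The transpose of a partial isometry is
    again one, which bounds the norm of M. *)
Lemma lowrank_factor (R : realType) (m n r : nat) (X : 'M[R]_(m, n)) :
  (\rank X <= r)%N ->
  exists (U : 'M[R]_(m, r)) (M : 'M[R]_(r, n)),
    [/\ X = U *m M, U *m U^T *m U = U & fnorm M <= fnorm X].
Proof.
move=> rX.
have [B [C XBC]] : exists (B : 'M[R]_(m, r)) (C : 'M[R]_(r, n)), X = B *m C.
  (* The full-rank factorization is padded with zeros to inner dimension [r]. *)
  exists (col_base X *m pid_mx (\rank X)), (pid_mx (\rank X) *m row_base X).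
  rewrite mulmxA -(mulmxA (col_base X)) mul_pid_mx minnn (minn_idPr rX).
  by rewrite pid_mx_1 mulmx1 mulmx_base.
have [U [UUU UB]] := exists_partial_isometry B.
exists U, (U^T *m X); split => //; first by rewrite mulmxA XBC mulmxA UB.
apply: fnorm_partial_isometry.
by rewrite -{4}UUU !trmx_mul !trmxK mulmxA.
Qed.

Lemma fnorm1mx (R : realType) (r : nat) :
  fnorm (1%:M : 'M[R]_r) = Num.sqrt r%:R.
Proof.
rewrite /fnorm; congr Num.sqrt.
rewrite (eq_bigr (fun=> 1)) ?sumr_const ?card_ord // => i _.
rewrite (bigD1 i) //= mxE eqxx expr1n big1 ?addr0 // => j ji.
by rewrite mxE eq_sym (negPf ji) expr0n.
Qed.

Lemma fnorm_linear_bound (R : realType) (m n p : nat)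
    (A : {linear 'M[R]_(m, n) -> 'cV[R]_p}) :
  exists2 K : R, 0 <= K & forall X, fnorm (A X) <= K * fnorm X.
Proof.
exists (\sum_(q : 'I_m * 'I_n) fnorm (A (delta_mx q.1 q.2))).
  by apply: sumr_ge0 => q _; exact: fnorm_ge0.
move=> X; rewrite {1}(matrix_sum_delta X) pair_bigA linear_sum /=.
apply: le_trans (ler_fnorm_sum _) _; rewrite mulr_suml.
apply: ler_sum => q _; rewrite linearZ /= fnormZ mulrC.
by rewrite ler_wpM2l ?fnorm_ge0 // ler_entry_fnorm.
Qed.

(** * Binomial bounds and finite nets *)

Lemma ffact_le_expn n k : (n ^_ k <= n ^ k)%N.
Proof.
elim: k => [//|k IH]; rewrite ffactnSr expnSr.
by rewrite leq_mul // leq_subr.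
Qed.

(** The single term k^k / k! of the exponential series is at most e^k, and the falling factorial of
    n is at most n^k. *)
Lemma binomial_le (R : realType) (n k : nat) : (0 < k)%N ->
  'C(n, k)%:R <= (expR 1 * n%:R / k%:R) ^+ k :> R.
Proof.
case: k => // k _.
have h : (k.+1%:R : R) ^+ k.+1 / k.+1`!%:R <= expR 1 ^+ k.+1.
  rewrite -expRM_natr mul1r.
  have := @expR_ge1Dxn R k.+1%:R k (ler0n _ _); lra.
have f0 : 0 < k.+1`!%:R :> R by rewrite ltr0n fact_gt0.
rewrite expr_div_n exprMn ler_pdivlMr ?exprn_gt0 ?ltr0n //.
rewrite -(ler_pM2l f0) mulrA -natrM mulnC bin_ffact.
rewrite ler_pdivrMr // in h.
apply: le_trans (_ : n%:R ^+ k.+1 * (expR 1 ^+ k.+1 * k.+1`!%:R) <= _).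
  apply: ler_pM; rewrite ?exprn_ge0 ?ler0n //.
  by rewrite -natrX ler_nat ffact_le_expn.
by rewrite mulrC -mulrA mulrCA.
Qed.

Definition supported (R : realType) (m n : nat) (Om : {set 'I_m * 'I_n})
    (X : 'M[R]_(m, n)) :=
  forall i j, (i, j) \notin Om -> X i j = 0.

Lemma supported_fnormE (R : realType) (m n : nat) (Om : {set 'I_m * 'I_n})
    (X : 'M[R]_(m, n)) : supported Om X ->
  fnorm X ^+ 2 = \sum_(p in Om) X p.1 p.2 ^+ 2.
Proof.
move=> sX; rewrite fnormE [RHS]big_mkcond; apply: eq_bigr => -[i j] _ /=.
by case: ifPn => // /sX ->; rewrite expr0n.
Qed.

Lemma supported_ler_sum (R : realType) (m n : nat) (Om : {set 'I_m * 'I_n})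
    (X : 'M[R]_(m, n)) : supported Om X ->
  \sum_(p in Om) `|X p.1 p.2| <= Num.sqrt #|Om|%:R * fnorm X.
Proof.
move=> sX.
have := cauchy_schwarz_sum (mem Om) (fun=> 1 : R) (fun p => `|X p.1 p.2|).
rewrite (eq_bigr (fun p => `|X p.1 p.2|)); last by move=> p _; rewrite mul1r.
rewrite [X in Num.sqrt X * _](eq_bigr (fun=> 1)); last first.
  by move=> p _; rewrite expr1n.
rewrite sumr_const.
rewrite [X in _ * Num.sqrt X](eq_bigr (fun p => X p.1 p.2 ^+ 2)); last first.
  by move=> p _; rewrite real_normK ?num_real.
by rewrite -(supported_fnormE sX) sqrtr_sqr ger0_norm ?fnorm_ge0.
Qed.

(** A counting argument in place of a volume argument. Entries are rounded towards zero to multiples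
    of [h], so norms do not grow. By Cauchy-Schwarz the absolute values of the entries sum to at
    most sqrt(d) rho, so the integer coordinates sum to at most [k]. There are C(d + k, d) such
    tuples, and 2^d choices of signs. *)
Lemma ball_net (R : realType) (m n : nat) (Om : {set 'I_m * 'I_n})
    (rho eta : R) : (0 < #|Om|)%N -> 0 <= rho -> 0 < eta ->
  exists2 N : seq 'M[R]_(m, n),
    (size N)%:R <= (2 * expR 1 * (rho / eta + 1)) ^+ #|Om| &
    forall X, supported Om X -> fnorm X <= rho ->
      exists2 X', X' \in N &
        [/\ supported Om X', fnorm X' <= fnorm X & fnorm (X - X') <= eta].
Proof.
move=> Om_gt0 rho0 eta0; have /card_gt0P[p0 p0Om] := Om_gt0.
set d := #|Om|; have d0 : 0 < d%:R :> R by rewrite ltr0n.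
(* A rounding error of at most [h] in each of [d] entries has Frobenius norm at most sqrt(d) h =
   eta, and sqrt(d) rho / h = d rho / eta. *)
pose k := Num.truncn (d%:R * rho / eta); pose h := eta / Num.sqrt d%:R.
have sd0 : 0 < Num.sqrt d%:R :> R by rewrite sqrtr_gt0.
have h0 : 0 < h by rewrite divr_gt0.
(* [b] holds the positions of negative entries and [t] the magnitudes in units of [h]. *)
pose f (b : {set 'I_m * 'I_n}) (t : d.-tuple 'I_k.+1) : 'M[R]_(m, n) :=
  \matrix_(i, j) if (i, j) \in Om then
    (-1) ^+ ((i, j) \in b) * (h * (tnth t (enum_rank_in p0Om (i, j)))%:R)
  else 0.
exists [seq f b t | b <- enum (powerset Om),
   t <- enum [set t : d.-tuple 'I_k.+1 | (\sum_(i <- t) i <= k)%N]%SET].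
  rewrite size_allpairs -!cardE card_powerset card_partial_ord_partitions.
  rewrite natrM natrX -mulrA exprMn ler_wpM2l ?exprn_ge0 //.
  apply: le_trans (binomial_le _ _ _) _ => //.
  rewrite lerXn2r ?nnegrE ?divr_ge0 ?mulr_ge0 ?expR_ge0 ?ler0n //.
    by rewrite addr_ge0 // divr_ge0 // ltW.
  rewrite -mulrA ler_wpM2l ?expR_ge0 // natrD mulrDl divff ?gt_eqF // addrC.
  rewrite lerD2r ler_pdivrMr //.
  have /andP[+ _] := @truncn_itv R (d%:R * rho / eta)
    (divr_ge0 (mulr_ge0 (ltW d0) rho0) (ltW eta0)).
  by move/le_trans; apply; rewrite -mulrA mulrC.
move=> X sX Xrho; pose c (p : 'I_m * 'I_n) := Num.truncn (`|X p.1 p.2| / h).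
have cP p : (c p)%:R * h <= `|X p.1 p.2| < ((c p)%:R + 1) * h.
  rewrite natr1 -ler_pdivlMr // -ltr_pdivrMr //.
  by apply: truncn_itv; rewrite divr_ge0 // ltW.
have sum_c : (\sum_(p in Om) c p <= k)%N.
  rewrite truncn_ge_nat; last by rewrite !mulr_ge0 ?invr_ge0 // ltW.
  rewrite natr_sum ler_pdivlMr // -(ler_pM2r h0).
  have -> : d%:R * rho * h = (Num.sqrt d%:R * rho) * eta.
    rewrite /h -{1}(sqr_sqrtr (ltW d0)); field.
    exact: lt0r_neq0.
  rewrite mulrAC ler_pM2r //.
  apply: le_trans (_ : Num.sqrt d%:R * fnorm X <= _); last by rewrite ler_pM2l.
  apply: le_trans (supported_ler_sum sX); rewrite mulr_suml.
  by apply: ler_sum => p _; case/andP: (cP p).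
have c_le p : p \in Om -> (c p < k.+1)%N.
  move=> pOm; rewrite ltnS; apply: leq_trans sum_c.
  by rewrite (bigD1 p) //= leq_addr.
pose b := [set p in Om | X p.1 p.2 < 0]%SET.
pose t : d.-tuple 'I_k.+1 := [tuple inord (c (enum_val l)) | l < d].
have tE p : p \in Om -> tnth t (enum_rank_in p0Om p) = c p :> nat.
  by move=> pOm; rewrite tnth_mktuple inordK enum_rankK_in // c_le.
have fE i j : (i, j) \in Om ->
    f b t i j = (-1) ^+ (X i j < 0)%R * ((c (i, j))%:R * h).
  by move=> ij; rewrite mxE ij tE // inE ij (mulrC h).
have sf : supported Om (f b t) by move=> i j /negPf ij; rewrite mxE ij.
exists (f b t).
  apply: allpairs_f; rewrite mem_enum.
    by rewrite inE; apply/fintype.subsetP => p; rewrite inE => /andP[].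
  rewrite inE big_tuple.
  rewrite (eq_bigr (fun l => c (enum_val l))); last first.
    by move=> l _; rewrite tnth_mktuple inordK // c_le // enum_valP.
  by rewrite -(big_enum_val (A := mem Om) c).
split => //.
  rewrite fnorm_le_sqr (supported_fnormE sf) (supported_fnormE sX).
  apply: ler_sum => -[i j] ij /=.
  rewrite fE // exprMn sqrr_sign mul1r -[leRHS]real_normK ?num_real //.
  have /andP[h1 _] := cP (i, j).
  by rewrite ler_sqr ?nnegrE // mulr_ge0 // ltW.
have subE (Y : 'M[R]_(m, n)) i j : (X - Y) i j = X i j - Y i j by rewrite !mxE.
have sXf : supported Om (X - f b t).
  by move=> i j ij; rewrite subE sX // sf // subr0.
rewrite -ler_sqr ?nnegrE ?fnorm_ge0 ?(ltW eta0) // (supported_fnormE sXf).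
apply: le_trans (_ : \sum_(p in Om) h ^+ 2 <= _); last first.
  rewrite sumr_const -mulr_natl -/d /h expr_div_n sqr_sqrtr ?(ltW d0) //.
  by rewrite mulrC divfK ?gt_eqF.
apply: ler_sum => -[i j] ij; rewrite subE fE //=.
have /andP[/= h1 h2] := cP (i, j).
rewrite -[leLHS]real_normK ?num_real // ler_sqr ?nnegrE ?(ltW h0) // ler_norml.
move: h1 h2; rewrite mulrDl mul1r.
case: (ltrP (X i j) 0) => X0; rewrite /= ?expr1 ?expr0.
  by rewrite ltr0_norm //; lra.
by rewrite ger0_norm //; lra.
Qed.

Lemma superset_card (T : finType) (B : {set T}) (s : nat) :
  (#|B| <= s <= #|T|)%N -> exists2 A : {set T}, B \subset A & #|A| = s.
Proof.
case/andP => Bs sT; pose q := enum B ++ take (s - #|B|) (enum (~: B)).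
exists [set x in q]%SET.
  by apply/fintype.subsetP => x xB; rewrite inE mem_cat mem_enum xB.
have uq : uniq q.
  rewrite cat_uniq enum_uniq take_uniq ?enum_uniq // andbT.
  apply/hasPn => x /mem_take; rewrite mem_enum inE => /negPf xB.
  by rewrite mem_enum xB.
rewrite cardsE (card_uniqP uq) size_cat -cardE size_takel ?subnKC //.
by rewrite -cardE leq_subLR cardsC.
Qed.

Lemma supported_nnz (R : realType) (m n : nat) (Om : {set 'I_m * 'I_n})
    (X : 'M[R]_(m, n)) : supported Om X -> (nnz X <= #|Om|)%N.
Proof.
move=> sX; apply/subset_leq_card/fintype.subsetP => -[i j]; rewrite inE /=.
by apply: contraNT => /sX ->.
Qed.

(** Union of the nets over all supports of cardinality exactly [s], a smaller support being enlarged
    first. [S] and its approximant share one support, so their difference is again [s]-sparse; this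
    is needed to bound the image of the error. *)
Lemma sparse_net (R : realType) (m n s : nat) (rho eta : R) :
  (0 < s <= m * n)%N -> 0 <= rho -> 0 < eta ->
  exists2 N : seq 'M[R]_(m, n),
    (size N)%:R <= 'C(m * n, s)%:R * (2 * expR 1 * (rho / eta + 1)) ^+ s &
    forall S, (nnz S <= s)%N -> fnorm S <= rho ->
      exists2 S', S' \in N &
        [/\ (nnz (S - S') <= s)%N & fnorm (S - S') <= eta].
Proof.
case/andP => s0 smn rho0 eta0.
have /choice[NS hNS] : forall Om : {set 'I_m * 'I_n},
    exists N : seq 'M[R]_(m, n), #|Om| = s ->
    (size N)%:R <= (2 * expR 1 * (rho / eta + 1)) ^+ s /\
    forall X, supported Om X -> fnorm X <= rho ->
      exists2 X', X' \in N &
        [/\ supported Om X', fnorm X' <= fnorm X & fnorm (X - X') <= eta].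
  move=> Om; have [Oms|] := eqVneq #|Om| s; last by move=> /eqP Oms; exists [::].
  have Om0 : (0 < #|Om|)%N by rewrite Oms.
  have [N N1 N2] := @ball_net R m n Om rho eta Om0 rho0 eta0.
  by exists N => _; rewrite -Oms.
pose D := [set Om : {set 'I_m * 'I_n} | #|Om| == s]%SET.
exists (flatten [seq NS Om | Om <- enum D]).
  have -> : 'C(m * n, s) = size (enum D).
    by rewrite -cardE card_draws card_prod !card_ord.
  have : forall Om, Om \in enum D -> #|Om| = s.
    by move=> Om; rewrite mem_enum inE => /eqP.
  elim: (enum D) => [|Om q IH] hq; first by rewrite mul0r.
  rewrite /= size_cat natrD -natr1 mulrDl mul1r addrC lerD //.
    by apply: IH => Om' hOm'; apply: hq; rewrite inE hOm' orbT.
  by have [|+ _] := hNS Om => //; apply: hq; rewrite mem_head.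
move=> S Ss Srho.
have [|Om suppS Oms] := @superset_card _
    [set ij : 'I_m * 'I_n | S ij.1 ij.2 != 0]%SET s.
  by rewrite card_prod !card_ord smn andbT.
have sS : supported Om S.
  move=> i j ij; apply/eqP; apply: contraNT ij => Sij.
  by move/fintype.subsetP: suppS; apply; rewrite inE.
have [_ /(_ _ sS Srho) [S' S'N [sS' _ hS']]] := hNS Om Oms.
exists S'.
  by apply/flattenP; exists (NS Om) => //; apply: map_f; rewrite mem_enum inE Oms.
split => //; rewrite -Oms; apply: supported_nnz => i j ij.
by rewrite !mxE sS // sS' // subr0.
Qed.

Lemma matrix_ball_net (R : realType) (m n : nat) (rho eta : R) :
  (0 < m * n)%N -> 0 <= rho -> 0 < eta ->
  exists2 N : seq 'M[R]_(m, n),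
    (size N)%:R <= (2 * expR 1 * (rho / eta + 1)) ^+ (m * n) &
    forall X, fnorm X <= rho ->
      exists2 X', X' \in N & fnorm X' <= fnorm X /\ fnorm (X - X') <= eta.
Proof.
move=> mn0 rho0 eta0.
have cT : #|[set: 'I_m * 'I_n]%SET| = (m * n)%N.
  by rewrite cardsT card_prod !card_ord.
have [|N N1 N2] := @ball_net R m n [set: 'I_m * 'I_n]%SET rho eta _ rho0 eta0.
  by rewrite cT.
exists N; first by rewrite -cT.
move=> X Xrho; have [i j|X' X'N [_ X1 X2]] := N2 X _ Xrho; first by rewrite inE.
by exists X'.
Qed.

(** The error is recorded as a sum of rank-[r] and [s]-sparse terms and not just by its norm,
    because a uniform bound on the linear map will be available only on such matrices. *)
Definition lowrank_sparse_cover (R : realType) (m n r s : nat) (tau eps : R)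
    (N : seq 'M[R]_(m, n)) : Prop :=
  forall L S, (\rank L <= r)%N -> (nnz S <= s)%N ->
    fnorm L <= tau -> fnorm S <= tau ->
    exists2 X', X' \in N & exists Y1 Y2 Y3,
      [/\ L + S = X' + (Y1 + Y2 + Y3),
          (\rank Y1 <= r)%N, (\rank Y2 <= r)%N, (nnz Y3 <= s)%N &
          [/\ fnorm Y1 <= eps, fnorm Y2 <= eps & fnorm Y3 <= eps]].

(** The error of the low-rank factor is UM - U'M' = U(M - M') + (U - U')M'. The first term is
    controlled because U is a partial isometry, the second by the product of norms with |M'| <= |M|
    <= tau. Hence U, of norm at most sqrt(r), is approximated to precision eps / tau. *)
Lemma lowrank_sparse_net (R : realType) (m n r s : nat) (tau eps : R) :
  (0 < m)%N -> (0 < n)%N -> (0 < r)%N -> (0 < s <= m * n)%N ->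
  0 < tau -> 0 < eps ->
  exists2 N : seq 'M[R]_(m, n),
    (size N)%:R <= 'C(m * n, s)%:R
      * (2 * expR 1 * (Num.sqrt r%:R * tau / eps + 1)) ^+ (m * r + r * n + s) &
    lowrank_sparse_cover r s tau eps N.
Proof.
move=> m0 n0 r0 smn tau0 eps0; have et0 : 0 < eps / tau by rewrite divr_gt0.
have [||//|NU NU1 NU2] :=
  @matrix_ball_net R m r (Num.sqrt r%:R) (eps / tau).
- by rewrite muln_gt0 m0.
- exact: sqrtr_ge0.
have [||//|NM NM1 NM2] := @matrix_ball_net R r n tau eps.
- by rewrite muln_gt0 r0.
- exact: ltW.
have [//||//|NS NS1 NS2] := @sparse_net R m n s tau eps.
  exact: ltW.
exists [seq Q.1 *m Q.2 + S' | Q <- [seq (U', M') | U' <- NU, M' <- NM], S' <- NS].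
  have r1 : 1 <= Num.sqrt r%:R :> R.
    by rewrite -[leLHS]sqrtr1 ler_wsqrtr // ler1n.
  have te : 0 <= tau / eps by rewrite divr_ge0 // ltW.
  have base0 : 0 <= 2 * expR 1 * (tau / eps + 1) :> R.
    by rewrite !mulr_ge0 ?expR_ge0 ?addr_ge0.
  set B := 2 * expR 1 * (Num.sqrt r%:R * tau / eps + 1).
  have baseX k : (2 * expR 1 * (tau / eps + 1)) ^+ k <= B ^+ k.
    have le_base : 2 * expR 1 * (tau / eps + 1) <= B.
      by rewrite ler_wpM2l ?mulr_ge0 ?expR_ge0 // lerD2r -mulrA ler_peMl.
    by rewrite lerXn2r // nnegrE //; apply: le_trans le_base.
  have hU : (size NU)%:R <= B ^+ (m * r).
    by apply: le_trans NU1 _; rewrite invf_div mulrA.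
  have hM : (size NM)%:R <= B ^+ (r * n) by exact: le_trans NM1 _.
  have hS : (size NS)%:R <= 'C(m * n, s)%:R * B ^+ s.
    by apply: le_trans NS1 _; rewrite ler_wpM2l.
  rewrite !size_allpairs !natrM !exprD mulrCA; apply: ler_pM => //.
  exact: ler_pM.
move=> L S rL sS Lt St.
have [U [M [LUM UUU ML]]] := lowrank_factor rL.
have Ur : fnorm U <= Num.sqrt r%:R.
  by rewrite -fnorm1mx -{1}(mulmx1 U) fnorm_partial_isometry.
have [U' U'N [_ UU']] := NU2 _ Ur.
have Mt : fnorm M <= tau by exact: le_trans Lt.
have [M' M'N [M'M MM']] := NM2 _ Mt.
have [S' S'N [sSS' SS']] := NS2 _ sS St.
exists (U' *m M' + S').
  apply/allpairsP; exists ((U', M'), S'); split => //.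
  by apply/allpairsP; exists (U', M').
exists (U *m (M - M')), ((U - U') *m M'), (S - S'); split => //.
- rewrite LUM mulmxBr mulmxBl [_ - _ + (_ - _)]addrA subrK.
  by rewrite addrACA [U' *m M' + _]addrC subrK [S' + _]addrC subrK.
- by apply: leq_trans (mxrankM_maxl _ _) _; exact: rank_leq_col.
- by apply: leq_trans (mxrankM_maxl _ _) _; exact: rank_leq_col.
split => //; first exact: le_trans (fnorm_partial_isometry _ UUU) MM'.
apply: le_trans (fnorm_mulmx _ _) _.
have -> : eps = eps / tau * tau by rewrite divfK // gt_eqF.
by apply: ler_pM; rewrite ?fnorm_ge0 //; apply: le_trans M'M _.
Qed.

(** * Transfer from the net to all sums of low-rank and sparse matrices *)

Lemma nnz0 (R : realType) (m n : nat) : nnz (0 : 'M[R]_(m, n)) = 0%N.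
Proof.
by apply/eqP; rewrite cards_eq0; apply/eqP/setP => q; rewrite !inE mxE eqxx.
Qed.

Lemma nnz_scale (R : realType) (m n : nat) (a : R) (X : 'M[R]_(m, n)) :
  (nnz (a *: X) <= nnz X)%N.
Proof.
apply/subset_leq_card/fintype.subsetP => q; rewrite !inE mxE.
by apply: contraNN => /eqP ->; rewrite mulr0.
Qed.

(** To be read with a = |X'|, y = |A X'| and z = |A X|, where |X| = 1 and X' is the net point
    approximating X. *)
Lemma perturbed_square_bounds (R : realFieldType) (Delta a y z : R) :
  0 < Delta < 1 -> 0 <= y -> 0 <= z ->
  `|a - 1| <= Delta / 32 -> `|z - y| <= Delta / 16 ->
  `|y ^+ 2 - a ^+ 2| <= Delta / 2 * a ^+ 2 ->
  1 - Delta <= z ^+ 2 <= 1 + Delta.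
Proof.
case/andP => D0 D1 y0 z0; rewrite !ler_norml.
move=> /andP[a1 a2] /andP[z1 z2] /andP[y1 y2].
have a2_le : a ^+ 2 <= 1 + 3 * (Delta / 32) by nra.
have a2_ge : 1 - 2 * (Delta / 32) <= a ^+ 2 by nra.
have y_le : y <= 4 / 3 by nra.
have zy : `|z ^+ 2 - y ^+ 2| <= Delta / 16 * 3.
  rewrite subr_sqr normrM; apply: ler_pM => //; first by rewrite ler_norml z1 z2.
  by rewrite ger0_norm ?addr_ge0 //; lra.
move: zy; rewrite ler_norml => /andP[zy1 zy2].
have Da : Delta / 2 * a ^+ 2 <= Delta / 2 * (1 + 3 / 32).
  by rewrite ler_wpM2l //; lra.
by apply/andP; split; lra.
Qed.

Lemma cover_approx (R : realType) (m n p r s : nat) (tau eps K : R)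
    (A : {linear 'M[R]_(m, n) -> 'cV[R]_p}) (N : seq 'M[R]_(m, n))
    (L S : 'M[R]_(m, n)) :
  lowrank_sparse_cover r s tau eps N -> 0 <= K ->
  (forall Y, (\rank Y <= r)%N || (nnz Y <= s)%N ->
     fnorm (A Y) <= K * fnorm Y) ->
  (\rank L <= r)%N -> (nnz S <= s)%N -> fnorm L <= tau -> fnorm S <= tau ->
  exists X', [/\ X' \in N, `|fnorm X' - fnorm (L + S)| <= 3 * eps &
    `|fnorm (A (L + S)) - fnorm (A X')| <= K * (3 * eps)].
Proof.
move=> netN K0 hK hL hS nL nS; have [X' X'N] := netN _ _ hL hS nL nS.
move=> [Y1] [Y2] [Y3] [E r1 r2 s3 [n1 n2 n3]]; exists X'; split => //.
  have h1 := ler_fnormB (L + S) (Y1 + Y2 + Y3).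
  have h2 := ler_fnormD X' (Y1 + Y2 + Y3).
  rewrite {1}E addrK in h1; rewrite -E in h2.
  have h3 := ler_fnormD (Y1 + Y2) Y3; have h4 := ler_fnormD Y1 Y2.
  by rewrite ler_norml; apply/andP; split; lra.
have h1 := ler_fnormB (A (L + S)) (A (Y1 + Y2 + Y3)).
have h2 := ler_fnormD (A X') (A (Y1 + Y2 + Y3)).
rewrite -linearB {1}E addrK in h1; rewrite -linearD -E in h2.
have h3 := ler_fnormD (A (Y1 + Y2)) (A Y3).
have h4 := ler_fnormD (A Y1) (A Y2).
rewrite -linearD in h3; rewrite -linearD in h4.
have k1 : fnorm (A Y1) <= K * eps.
  by apply: le_trans (hK _ _) _; rewrite ?r1 // ler_wpM2l.
have k2 : fnorm (A Y2) <= K * eps.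
  by apply: le_trans (hK _ _) _; rewrite ?r2 // ler_wpM2l.
have k3 : fnorm (A Y3) <= K * eps.
  by apply: le_trans (hK _ _) _; rewrite ?s3 ?orbT // ler_wpM2l.
by rewrite ler_norml; apply/andP; split; lra.
Qed.

(* The supremum k of fnorm (A Y) over the rank-r and s-sparse Y with fnorm Y <= 1
   satisfies k <= 5/4 * (1 + 1/32) + k / 32, by approximating Y from the cover. *)
Lemma lowrank_sparse_bounded (R : realType) (m n p r s : nat) (Delta tau : R)
    (A : {linear 'M[R]_(m, n) -> 'cV[R]_p}) (N : seq 'M[R]_(m, n))
    (X : 'M[R]_(m, n)) :
  0 < Delta < 1 -> 1 <= tau ->
  lowrank_sparse_cover r s tau (Delta / 96) N ->
  (forall X', X' \in N ->
    `|fnorm (A X') ^+ 2 - fnorm X' ^+ 2| <= Delta / 2 * fnorm X' ^+ 2) ->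
  (\rank X <= r)%N || (nnz X <= s)%N -> fnorm (A X) <= 2 * fnorm X.
Proof.
move=> hDelta tau1 netN isoN; have [D0 D1] := andP hDelta.
pose simple (Y : 'M[R]_(m, n)) := (\rank Y <= r)%N || (nnz Y <= s)%N.
have simpleZ a Y : simple Y -> simple (a *: Y).
  case/orP => h; apply/orP; [left|right]; apply: leq_trans h.
    exact: mxrank_scale.
  exact: nnz_scale.
pose E := [set fnorm (A Y) | Y in [set Y | simple Y /\ fnorm Y <= 1]].
have E0 : E 0.
  exists 0; last by rewrite linear0 fnorm0.
  by split; rewrite ?fnorm0 // /simple mxrank0.
have supE : has_sup E.
  split; first by exists 0.
  (* This [K] depends on [A]; it serves only to make the supremum finite. *)
  have [K K0 hK] := fnorm_linear_bound A.
  exists K => _ [Y [_ Y1] <-]; apply: le_trans (hK Y) _.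
  by rewrite ler_piMr.
set k := sup E.
have k0 : 0 <= k by apply: sup_upper_bound.
have hk Y : simple Y -> fnorm (A Y) <= k * fnorm Y.
  move=> sY; have [->|Y0] := eqVneq Y 0; first by rewrite linear0 !fnorm0 mulr0.
  have nY : 0 < fnorm Y by rewrite lt0r fnorm_eq0 Y0 fnorm_ge0.
  have : fnorm (A ((fnorm Y)^-1 *: Y)) <= k.
    apply: sup_upper_bound => //; exists ((fnorm Y)^-1 *: Y) => //.
    by split; [exact: simpleZ|rewrite fnorm_unit].
  by rewrite linearZ /= fnormZ normfV ger0_norm ?fnorm_ge0 // mulrC ler_pdivrMr.
have k2 : k <= 2.
  suff : k <= 5 / 4 * (1 + 1 / 32) + k * (1 / 32) by lra.
  apply: ge_sup; first by exists 0.
  move=> _ [Y [sY Y1] <-].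
  have [L [S [YLS hL hS [nL nS]]]] : exists L S, [/\ Y = L + S,
      (\rank L <= r)%N, (nnz S <= s)%N & fnorm L <= tau /\ fnorm S <= tau].
    have tau0 : 0 <= tau by apply: le_trans tau1.
    have Yt := le_trans Y1 tau1.
    case/orP: sY => h; [exists Y, 0|exists 0, Y];
      by rewrite ?addr0 ?add0r ?nnz0 ?mxrank0 ?fnorm0.
  have [X' [X'N]] := cover_approx netN k0 hk hL hS nL nS.
  rewrite -YLS !ler_norml => /andP[_ h1] /andP[_ h2].
  have := isoN _ X'N; rewrite ler_norml => /andP[_ h3].
  have nX' := fnorm_ge0 X'; have nAX' := fnorm_ge0 (A X').
  (* On the net |A X'|^2 <= (1 + Delta / 2) |X'|^2, and 1 + Delta / 2 <= 3/2 <= (5/4)^2. *)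
  have h4 : fnorm (A X') <= 5 / 4 * fnorm X'.
    rewrite -ler_sqr ?nnegrE ?mulr_ge0 // exprMn.
    have := sqr_ge0 (fnorm X'); nra.
  have h5 : k * (3 * (Delta / 96)) <= k * (1 / 32) by rewrite ler_wpM2l //; lra.
  lra.
move=> sX; apply: le_trans (hk X sX) _.
by rewrite ler_wpM2r // fnorm_ge0.
Qed.

(** By homogeneity L + S may be scaled to norm 1, which brings both components into the ball of
    radius [tau]. The three error terms of size Delta / 96 then cost Delta / 32 in the norm and,
    with the bound 2 on the map, Delta / 16 in the norm of the image. *)
Lemma rip_of_cover (R : realType) (m n p r s : nat) (Delta tau : R)
    (A : {linear 'M[R]_(m, n) -> 'cV[R]_p}) (N : seq 'M[R]_(m, n))
    (L S : 'M[R]_(m, n)) :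
  0 < Delta < 1 -> 1 <= tau ->
  lowrank_sparse_cover r s tau (Delta / 96) N ->
  (forall X', X' \in N ->
    `|fnorm (A X') ^+ 2 - fnorm X' ^+ 2| <= Delta / 2 * fnorm X' ^+ 2) ->
  (\rank L <= r)%N -> (nnz S <= s)%N ->
  fnorm L <= tau * fnorm (L + S) -> fnorm S <= tau * fnorm (L + S) ->
  (1 - Delta) * fnorm (L + S) ^+ 2 <= fnorm (A (L + S)) ^+ 2
    <= (1 + Delta) * fnorm (L + S) ^+ 2.
Proof.
move=> hDelta tau1 netN isoN hL hS nL nS; set X := L + S.
have bounded Y :=
  @lowrank_sparse_bounded _ _ _ _ _ _ _ _ A N Y hDelta tau1 netN isoN.
have [X0|X0] := eqVneq X 0.
  by rewrite X0 linear0 !fnorm0 expr0n /= !mulr0 lexx.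
have nX : 0 < fnorm X by rewrite lt0r fnorm_eq0 X0 fnorm_ge0.
pose c := (fnorm X)^-1; have c0 : 0 <= c by rewrite invr_ge0 fnorm_ge0.
have cE : fnorm X ^+ 2 * c ^+ 2 = 1 by rewrite -exprMn divff ?gt_eqF // expr1n.
have cX : fnorm (c *: L + c *: S) = 1 by rewrite -scalerDr fnorm_unit.
have cle (Y : 'M[R]_(m, n)) : fnorm Y <= tau * fnorm X -> fnorm (c *: Y) <= tau.
  by move=> hY; rewrite fnormZ ger0_norm // mulrC ler_pdivrMr.
have [X' [X'N h1 h2]] := cover_approx netN (ler0n R 2) bounded
  (leq_trans (mxrank_scale c L) hL) (leq_trans (nnz_scale c S) hS)
  (cle _ nL) (cle _ nS).
have e32 : 3 * (Delta / 96) = Delta / 32 by field.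
have e16 : 2 * (3 * (Delta / 96)) = Delta / 16 by field.
rewrite e16 in h2; rewrite cX e32 in h1.
have := perturbed_square_bounds hDelta (fnorm_ge0 (A X')) (fnorm_ge0 _) h1 h2
  (isoN _ X'N).
rewrite -scalerDr linearZ /= fnormZ ger0_norm // exprMn -/X => /andP[h3 h4].
have c20 : 0 < c ^+ 2 by rewrite exprn_gt0 // invr_gt0.
have mulc a : a * fnorm X ^+ 2 * c ^+ 2 = a by rewrite -mulrA cE mulr1.
by apply/andP; split; rewrite -(ler_pM2r c20) mulc mulrC.
Qed.

(** * Singular values and incoherence *)

Lemma mxrank_mxsub_le (F : fieldType) (m n m' n' : nat) (f : 'I_m' -> 'I_m)
    (g : 'I_n' -> 'I_n) (A : 'M[F]_(m, n)) :
  (\rank (mxsub f g A) <= \rank A)%N.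
Proof.
have -> : mxsub f g A = rowsub f 1%:M *m A *m colsub g 1%:M.
  by rewrite mul_rowsub_mx mul1mx -mxsub_mul mulmx1.
by apply: leq_trans (mxrankM_maxl _ _) _; exact: mxrankM_maxr.
Qed.

Lemma fnorm_orthogonal (R : realType) (m k n : nat) (W : 'M[R]_(m, k))
    (Y : 'M[R]_(k, n)) : W^T *m W = 1%:M -> fnorm (W *m Y) = fnorm Y.
Proof.
move=> hW; apply/eqP; rewrite eq_le !fnorm_le_sqr -eq_le !fnorm_trace trmx_mul.
by rewrite mulmxA -(mulmxA Y^T) hW mulmx1.
Qed.

Lemma svd_fnorm (R : realType) (m n : nat) (L : 'M[R]_(m, n)) W sigma Z :
  is_svd L W sigma Z ->
  fnorm L = fnorm (\matrix_(i < m, j < n)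
                     (if (i : nat) == j then sigma i else 0)).
Proof.
case=> hW hZ _ _ ->; rewrite -mulmxA fnorm_orthogonal //.
by rewrite -fnorm_tr trmx_mul trmxK fnorm_orthogonal // fnorm_tr.
Qed.

(** If sigma k were nonzero, monotonicity would make the leading block of size k + 1 of the middle
    factor an invertible diagonal matrix, and the rank of L would exceed r. *)
Lemma svd_rank (R : realType) (m n r : nat) (L : 'M[R]_(m, n)) W sigma Z k :
  is_svd L W sigma Z -> (\rank L <= r)%N -> (r <= k)%N -> (k < m)%N ->
  (k < n)%N -> sigma k = 0.
Proof.
case=> hW hZ s0 smon LE rL rk km kn; apply/eqP/negPn/negP => sk.
set D := (X in W *m X) in LE.
have DE : D = W^T *m L *m Z.
  by rewrite LE !mulmxA hW mul1mx -mulmxA hZ mulmx1.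
have rD : (\rank D <= r)%N.
  rewrite DE; apply: leq_trans (mxrankM_maxl _ _) _.
  by apply: leq_trans rL; exact: mxrankM_maxr.
have := mxrank_mxsub_le (widen_ord km) (widen_ord kn) D.
have -> : mxsub (widen_ord km) (widen_ord kn) D
          = diag_mx (\row_(i < k.+1) sigma i).
  apply/matrixP => i j; rewrite !mxE /= -val_eqE.
  by case: eqP => // ->; rewrite mulr1n.
rewrite mxrank_unit; last first.
  rewrite unitmxE det_diag unitfE prodf_seq_neq0; apply/allP => i _ /=.
  rewrite mxE gt_eqF //; apply: lt_le_trans (smon i k _); last by rewrite -ltnS.
  by rewrite lt0r sk s0.
by move/leq_trans => /(_ _ rD); rewrite ltnNge rk.
Qed.

(** An entry of L is a sum over a < r of U_ia sigma_a V_ja. Cauchy-Schwarz, the incoherence bounds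
    mu r / m and mu r / n on the squared rows, and sigma_a <= |L| give the estimate. *)
Lemma incoherent_entry (R : realType) (m n r : nat) (mu : R)
    (L : 'M[R]_(m, n)) i j :
  0 <= mu -> (\rank L <= r)%N -> incoherent r mu L ->
  L i j ^+ 2 <= (mu * r%:R) ^+ 2 / (m%:R * n%:R) * fnorm L ^+ 2.
Proof.
move=> mu0 rL [U [V [[rm [rn [W [sigma [Z [svd UE VE]]]]]] hU hV]]].
have nE := svd_fnorm svd; have sig0 k := @svd_rank _ _ _ _ _ _ _ _ k svd rL.
case: svd => _ _ _ _; set D := (X in W *m X).
rewrite -/D in nE => LE.
have Lij : L i j = \sum_(a < r) U i a * (sigma a * V j a).
  (* The decomposition can be cut at [r], since the later singular values vanish by the rank
     bound. *)
  have -> : L = U *m diag_mx (\row_(a < r) sigma a) *m V^T.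
    have -> : U = W *m colsub (widen_ord rm) 1%:M by rewrite mulmx_colsub mulmx1.
    have -> : V = Z *m colsub (widen_ord rn) 1%:M by rewrite mulmx_colsub mulmx1.
    rewrite LE trmx_mul !mulmxA; congr (_ *m _); rewrite -!mulmxA; congr (_ *m _).
    apply/matrixP => k l; rewrite mulmxA mul_mx_diag !mxE.
    under eq_bigr do rewrite !mxE.
    have [kr|rk] := ltnP k r.
      rewrite (bigD1 (Ordinal kr)) //= big1 ?addr0 => [|a /eqP ak].
        rewrite -!val_eqE /= eqxx mul1r [(l : nat) == k]eq_sym.
        by case: eqP => _; rewrite ?mulr1 ?mulr0.
      case: eqP => [kE|_]; rewrite ?mul0r //.
      by case: ak; apply/val_inj/esym; exact: (congr1 val kE).
    rewrite big1 => [|a _].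
      by case: eqP => // kl; rewrite sig0 // kl.
    case: eqP => [kE|_]; rewrite ?mul0r //.
    by move: rk; rewrite kE leqNgt /= ltn_ord.
  rewrite mul_mx_diag mxE; apply: eq_bigr => a _.
  by rewrite !mxE mulrA.
have rowU : \sum_(a < r) U i a ^+ 2 <= mu * r%:R / m%:R.
  have := hU i; rewrite -ler_sqr ?nnegrE ?fnorm_ge0 ?sqrtr_ge0 //.
  rewrite -colE !sqr_sqrtr ?divr_ge0 ?mulr_ge0 //; last first.
    by apply: sumr_ge0 => a _; apply: sumr_ge0 => b _; exact: sqr_ge0.
  by under eq_bigr do rewrite big_ord1 !mxE.
have rowV : \sum_(a < r) V j a ^+ 2 <= mu * r%:R / n%:R.
  have := hV j; rewrite -ler_sqr ?nnegrE ?fnorm_ge0 ?sqrtr_ge0 //.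
  rewrite -colE !sqr_sqrtr ?divr_ge0 ?mulr_ge0 //; last first.
    by apply: sumr_ge0 => a _; apply: sumr_ge0 => b _; exact: sqr_ge0.
  by under eq_bigr do rewrite big_ord1 !mxE.
rewrite Lij; apply: le_trans (cauchy_schwarz_sqr _ _ _) _.
apply: le_trans (_ : (mu * r%:R / m%:R) * (mu * r%:R / n%:R * fnorm L ^+ 2) <= _).
  apply: ler_pM => //; try by apply: sumr_ge0 => a _; exact: sqr_ge0.
  apply: le_trans (_ : (\sum_(a < r) V j a ^+ 2) * fnorm L ^+ 2 <= _).
    rewrite mulr_suml; apply: ler_sum => a _; rewrite exprMn mulrC.
    apply: ler_wpM2l; first exact: sqr_ge0.
    (* Each singular value is an entry of [D], whose norm is that of [L]. *)
    have := ler_entry_fnorm D (widen_ord rm a) (widen_ord rn a).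
    rewrite mxE /= eqxx -nE => h; rewrite -real_normK ?num_real //.
    by rewrite ler_sqr ?nnegrE ?fnorm_ge0.
  by rewrite ler_wpM2r // sqr_ge0.
rewrite invfM le_eqVlt; apply/orP; left; apply/eqP; ring.
Qed.

(** Only the entries of L on the support of S enter the inner product; there are at most s of them,
    each bounded by incoherence. *)
Lemma incoherent_quasi_orthogonal (R : realType) (m n r s : nat) (mu : R)
    (L S : 'M[R]_(m, n)) :
  0 <= mu -> (\rank L <= r)%N -> incoherent r mu L -> (nnz S <= s)%N ->
  (\sum_(q : 'I_m * 'I_n) L q.1 q.2 * S q.1 q.2) ^+ 2
  <= mu ^+ 2 * (r%:R ^+ 2 * s%:R / (m%:R * n%:R)) * fnorm L ^+ 2 * fnorm S ^+ 2.
Proof.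
move=> mu0 rL iL sS; pose Om := [set q : 'I_m * 'I_n | S q.1 q.2 != 0]%SET.
have supS : supported Om S by move=> i j; rewrite inE negbK => /eqP.
have -> : \sum_(q : 'I_m * 'I_n) L q.1 q.2 * S q.1 q.2
          = \sum_(q in Om) L q.1 q.2 * S q.1 q.2.
  rewrite [RHS]big_mkcond; apply: eq_bigr => -[i j] _ /=.
  by case: ifPn => // /supS ->; rewrite mulr0.
apply: le_trans (cauchy_schwarz_sqr _ _ _) _.
rewrite -(supported_fnormE supS) ler_wpM2r ?sqr_ge0 //.
apply: le_trans (_ : \sum_(q in Om)
    ((mu * r%:R) ^+ 2 / (m%:R * n%:R) * fnorm L ^+ 2) <= _).
  by apply: ler_sum => q _; exact: incoherent_entry.
rewrite sumr_const -[X in X <= _]mulr_natl.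
rewrite [leRHS](_ : _ = s%:R * ((mu * r%:R) ^+ 2 / (m%:R * n%:R) * fnorm L ^+ 2)).
  apply: ler_pM; rewrite ?ler_nat //.
  by apply: mulr_ge0 (divr_ge0 (sqr_ge0 _) (mulr_ge0 _ _)) (sqr_ge0 _).
by rewrite exprMn; ring.
Qed.

(** Used with x and y the squared norms of the two components and t their inner product. With z = g
    x, the inequality of arithmetic and geometric means gives 2 |t| <= 2 sqrt(z y) <= z + y. *)
Lemma quasi_orthogonal_component (R : realFieldType) (g x y t : R) :
  0 <= g -> 0 <= x -> 0 <= y -> t ^+ 2 <= g * x * y ->
  (1 - g) * x <= x + y + 2 * t.
Proof.
move=> g0 x0 y0 h; rewrite -subr_ge0.
have -> : x + y + 2 * t - (1 - g) * x = g * x + y + 2 * t by ring.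
move: h (mulr_ge0 g0 x0); move: (g * x) => z h z0.
rewrite leNgt; apply/negP => neg.
have : (z + y) ^+ 2 < (2 * t) ^+ 2 by nra.
by have := sqr_ge0 (z - y); rewrite sqrrB sqrrD exprMn; lra.
Qed.

Lemma LS_decomposition (R : realType) (m n r s : nat) (mu : R)
    (X : 'M[R]_(m, n)) (g := mu ^+ 2 * (r%:R ^+ 2 * s%:R / (m%:R * n%:R))) :
  0 <= mu -> LS r s mu X ->
  exists L S, [/\ X = L + S, (\rank L <= r)%N, (nnz S <= s)%N,
    (1 - g) * fnorm L ^+ 2 <= fnorm X ^+ 2 &
    (1 - g) * fnorm S ^+ 2 <= fnorm X ^+ 2].
Proof.
move=> mu0 [L [S [XE rL sS iL]]]; exists L, S.
have h := incoherent_quasi_orthogonal mu0 rL iL sS; rewrite -/g in h.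
have g0 : 0 <= g by apply: (mulr_ge0 (sqr_ge0 _) (divr_ge0
    (mulr_ge0 (sqr_ge0 _) (ler0n _ _)) (mulr_ge0 (ler0n _ _) (ler0n _ _)))).
split => //; rewrite XE fnormD_sqr.
  by apply: quasi_orthogonal_component; rewrite ?sqr_ge0.
rewrite [X in _ <= X + _]addrC.
by apply: quasi_orthogonal_component; rewrite ?sqr_ge0 // mulrAC.
Qed.

(** * The restricted isometry constant and dense subsets *)

Definition rip_on (R : realType) (m n p : nat) (D : set 'M[R]_(m, n))
    (Delta : R) (A : {linear 'M[R]_(m, n) -> 'cV[R]_p}) : Prop :=
  forall X, D X ->
    (1 - Delta) * fnorm X ^+ 2 <= fnorm (A X) ^+ 2
      <= (1 + Delta) * fnorm X ^+ 2.

(** This says that the infimum is admissible: for each X the inequalities hold with the infimum plus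
    any e > 0, and e tends to 0. *)
Lemma ric_leP (R : realType) (m n p r s : nat) (mu Delta : R)
    (A : {linear 'M[R]_(m, n) -> 'cV[R]_p}) :
  0 < Delta -> (ric r s mu A <= Delta) <-> rip_on (LS r s mu) Delta A.
Proof.
move=> D0; set E := [set delta : R | 0 < delta /\ rip_on (LS r s mu) delta A].
have lbE : has_lbound E by exists 0 => x [/ltW].
rewrite -[ric r s mu A]/(inf E); split=> [h|h]; last by apply: ge_inf.
have E0 : E !=set0.
  have [K K0 hK] := fnorm_linear_bound A.
  (* For this value the lower bound is nonpositive and the upper one exceeds K^2 |X|^2; without an
     admissible value [inf] would be a default. *)
  exists (K ^+ 2 + 1); split; first by rewrite ltr_wpDl // sqr_ge0.
  move=> X _; have nX := sqr_ge0 (fnorm X).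
  have : fnorm (A X) ^+ 2 <= K ^+ 2 * fnorm X ^+ 2.
    by rewrite -exprMn ler_sqr ?nnegrE ?mulr_ge0 ?fnorm_ge0.
  have := sqr_ge0 (fnorm (A X)); have := mulr_ge0 (sqr_ge0 K) nX.
  by move=> *; apply/andP; split; lra.
move=> X DX.
have near e : 0 < e ->
    (1 - Delta) * fnorm X ^+ 2 <= fnorm (A X) ^+ 2 + e * fnorm X ^+ 2
    /\ fnorm (A X) ^+ 2 <= (1 + Delta) * fnorm X ^+ 2 + e * fnorm X ^+ 2.
  move=> e0.
  have [x [_ /(_ _ DX)/andP[h1 h2]] xe] := inf_adherent e0 (conj E0 lbE).
  have xDe : x * fnorm X ^+ 2 <= (Delta + e) * fnorm X ^+ 2.
    by rewrite ler_wpM2r ?sqr_ge0 //; lra.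
  by split; lra.
have [X0|X0] := eqVneq X 0.
  by have [h1 h2] := near 1 ltr01; apply/andP; split; move: h1 h2;
    rewrite X0 fnorm0 expr0n /= !mulr0 !addr0.
have nX : 0 < fnorm X ^+ 2 by rewrite exprn_gt0 // lt0r fnorm_eq0 X0 fnorm_ge0.
apply/andP; split; apply/ler_addgt0Pr => e e0;
  by have [] := near (e / fnorm X ^+ 2) (divr_gt0 e0 nX);
    rewrite divfK ?gt_eqF.
Qed.

Lemma ler_fnorm_sup (R : realType) (m n : nat) (X : 'M[R]_(m, n)) (e : R) :
  (forall i j, `|X i j| <= e) -> fnorm X <= (m * n)%:R * e.
Proof.
move=> Xe; rewrite [X in fnorm X]matrix_sum_delta pair_bigA /=.
apply: le_trans (ler_fnorm_sum _) _.
apply: le_trans (_ : \sum_(q : 'I_m * 'I_n) e <= _); last first.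
  by rewrite sumr_const card_prod !card_ord mulr_natl.
apply: ler_sum => -[i j] _ /=; rewrite fnormZ -[leRHS]mulr1.
apply: ler_pM; rewrite ?fnorm_ge0 //.
rewrite fnorm_sqrt (bigD1 (i, j)) //= big1 => [|[k l] kl].
  by rewrite mxE !eqxx expr1n addr0 sqrtr1.
rewrite mxE; case: eqP => [ki|]; case: eqP => [lj|] //=; rewrite ?expr0n //.
by move: ki lj kl => /= -> ->; rewrite eqxx.
Qed.

(** [D] may contain no rational matrix. For each pair of a rational matrix and a precision, a point
    of [D] within that precision is chosen when one exists; there are countably many pairs. *)
Lemma exists_dense_sequence (R : realType) (m n : nat) (D : set 'M[R]_(m, n)) :
  D !=set0 -> exists F : nat -> 'M[R]_(m, n), (forall k, D (F k)) /\
    forall X, D X -> forall e : R, 0 < e -> exists k, fnorm (X - F k) <= e.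
Proof.
case=> X0 DX0.
pose close (c : 'M[rat]_(m, n) * nat) Y :=
  D Y /\ fnorm (Y - map_mx (@ratr R) c.1) <= c.2.+1%:R^-1.
have /choice[G hG] : forall c,
    exists Y, D Y /\ ((exists Z, close c Z) -> close c Y).
  move=> c; have [[Z hZ]|nZ] := pselect (exists Z, close c Z).
    by exists Z; split => //; case: hZ.
  by exists X0.
(* Indices that encode no pair are sent to the base point [X0]. *)
pose F i := oapp G X0 (unpickle i).
exists F; split.
  by move=> i; rewrite /F; case: unpickle => //= c; case: (hG c).
move=> X DX e e0; have e20 : 0 < e / 2 by lra.
have [k hk] := ltr_add_invr e20; rewrite add0r in hk.
set d : R := k.+1%:R^-1 in hk; have d0 : 0 < d by rewrite invr_gt0.
(* An entrywise error of [d'] costs at most mn d' <= d in Frobenius norm; the successor avoids a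
   zero denominator. *)
pose d' := d / (m * n).+1%:R; have d'0 : 0 < d' by rewrite divr_gt0.
have /choice[f hf] : forall q : 'I_m * 'I_n,
    exists y : rat, `|X q.1 q.2 - ratr y| <= d'.
  move=> q.
  have [|y] := @rat_in_itvoo R (X q.1 q.2 - d') (X q.1 q.2 + d').
    by lra.
  rewrite in_itv /= => /andP[y1 y2]; exists y.
  by rewrite ler_norml; apply/andP; split; lra.
pose c := (\matrix_(i, j) f (i, j), k).
have Xc : fnorm (X - map_mx (@ratr R) c.1) <= d.
  apply: le_trans (_ : (m * n)%:R * d' <= _).
    by apply: ler_fnorm_sup => i j; rewrite !mxE; exact: (hf (i, j)).
  rewrite /d' mulrC -mulrA ler_piMr ?(ltW d0) // mulrC ler_pdivrMr // mul1r.
  by rewrite ler_nat.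
have [_ Fc] : close c (F (pickle c)).
  rewrite /F pickleK /=; case: (hG c) => _; apply.
  by exists X.
exists (pickle c).
have := ler_fnormB (X - map_mx (@ratr R) c.1)
  (F (pickle c) - map_mx (@ratr R) c.1).
rewrite opprB addrA subrK -/d /= in Fc *; lra.
Qed.

(** Taking square roots turns the condition into bounds on norms with the constants [a] and [b].
    These pass to limits by the triangle inequality, with an error linear in the distance. *)
Lemma rip_on_dense (R : realType) (m n p : nat) (D D' : set 'M[R]_(m, n))
    (Delta : R) (A : {linear 'M[R]_(m, n) -> 'cV[R]_p}) :
  0 <= Delta <= 1 ->
  (forall X, D X -> forall e : R, 0 < e ->
     exists2 Y, D' Y & fnorm (X - Y) <= e) ->
  rip_on D' Delta A -> rip_on D Delta A.
Proof.
case/andP => D0 D1 dense rip'.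
pose a := Num.sqrt (1 - Delta); pose b := Num.sqrt (1 + Delta).
have aE : a ^+ 2 = 1 - Delta by rewrite sqr_sqrtr // subr_ge0.
have bE : b ^+ 2 = 1 + Delta by rewrite sqr_sqrtr // addr_ge0.
have [K K0 hK] := fnorm_linear_bound A.
have equiv X : ((1 - Delta) * fnorm X ^+ 2 <= fnorm (A X) ^+ 2
      <= (1 + Delta) * fnorm X ^+ 2)
    = (a * fnorm X <= fnorm (A X) <= b * fnorm X).
  rewrite -[in RHS]ler_sqr ?nnegrE ?mulr_ge0 ?fnorm_ge0 ?sqrtr_ge0 //.
  rewrite -[X in _ = _ && X]ler_sqr ?nnegrE ?mulr_ge0 ?fnorm_ge0 ?sqrtr_ge0 //.
  by rewrite !exprMn aE bE.
have a0 : 0 <= a by exact: sqrtr_ge0.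
have b0 : 0 <= b by exact: sqrtr_ge0.
move=> X DX; rewrite equiv; apply/andP.
have near e : 0 < e -> a * fnorm X <= fnorm (A X) + e * (a + b + K + 1) /\
    fnorm (A X) <= b * fnorm X + e * (a + b + K + 1).
  move=> e0; have [Y D'Y XY] := dense X DX e e0.
  have := rip' Y D'Y; rewrite equiv => /andP[h1 h2].
  have n1 := ler_fnormD (X - Y) Y; have n2 := ler_fnormB X (X - Y).
  have n3 := ler_fnormD (A (X - Y)) (A Y).
  have n4 := ler_fnormB (A X) (A (X - Y)).
  rewrite -linearD subrK in n3; rewrite -linearB in n4.
  rewrite subrK in n1; rewrite subKr in n2; rewrite subKr in n4.
  have n5 := le_trans (hK (X - Y)) (ler_wpM2l K0 XY).
  have n6 : a * fnorm X <= a * (fnorm Y + e) by rewrite ler_wpM2l //; lra.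
  have n7 : b * fnorm Y <= b * (fnorm X + e) by rewrite ler_wpM2l //; lra.
  have n8 := mulr_ge0 a0 (ltW e0); have n9 := mulr_ge0 b0 (ltW e0).
  have n10 := mulr_ge0 K0 (ltW e0).
  by split; lra.
have c0 : 0 < a + b + K + 1 by lra.
by split; apply/ler_addgt0Pr => e e0;
  have [] := near (e / (a + b + K + 1)) (divr_gt0 e0 c0);
  rewrite divfK ?gt_eqF.
Qed.

(** * Measurability and concentration *)

Lemma measurable_fnorm_sqr (d : measure_display) (T : measurableType d)
    (R : realType) (m n p : nat) (A : T -> {linear 'M[R]_(m, n) -> 'cV[R]_p})
    (X : 'M[R]_(m, n)) :
  random_linear_map A ->
  measurable_fun [set: T] (fun w => fnorm (A w X) ^+ 2).
Proof.
move=> mA; rewrite (_ : (fun w => _) = fun w => \sum_(i < p) (A w X i 0) ^+ 2).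
  by apply: measurable_sum => i; exact: measurable_realfun.measurable_funX.
apply/funext => w; rewrite sqr_sqrtr.
  by apply: eq_bigr => i _; rewrite big_ord1.
by apply: sumr_ge0 => i _; apply: sumr_ge0 => j _; exact: sqr_ge0.
Qed.

Lemma measurable_rip_on (d : measure_display) (T : measurableType d)
    (R : realType) (m n p : nat) (A : T -> {linear 'M[R]_(m, n) -> 'cV[R]_p})
    (D : set 'M[R]_(m, n)) (Delta : R) :
  0 <= Delta <= 1 -> random_linear_map A ->
  measurable [set w | rip_on D Delta (A w)].
Proof.
move=> hD mA; have [->|/set0P D0] := eqVneq D set0.
  rewrite (_ : [set w | _] = setT); first exact: measurableT.
  by apply/seteqP; split => // w _ X [].
have [F [FD Fdense]] := exists_dense_sequence D0.
rewrite (_ : [set w | _] = \bigcap_k [set w |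
    (1 - Delta) * fnorm (F k) ^+ 2 <= fnorm (A w (F k)) ^+ 2
      <= (1 + Delta) * fnorm (F k) ^+ 2]).
  apply: bigcapT_measurable => k.
  rewrite (_ : [set w | _] = [set: T] `&` (fun w => fnorm (A w (F k)) ^+ 2) @^-1`
     [set` `[(1 - Delta) * fnorm (F k) ^+ 2, (1 + Delta) * fnorm (F k) ^+ 2]]).
    by apply: measurable_fnorm_sqr => //; exact: measurable_itv.
  by rewrite setTI; apply/seteqP; split => w /=; rewrite in_itv.
apply/seteqP; split => [w h k _|w h]; first exact/h/FD.
apply: (@rip_on_dense _ _ _ _ _ (range F)) => //.
  by move=> X DX e e0; have [k hk] := Fdense X DX e e0; exists (F k).
by move=> _ [k _ <-]; exact: h.
Qed.

(** Union bound: the exceptional event is built along the list, each nonzero matrix adding its own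
    deviation event. The zero matrix, to which the tail bound does not apply, satisfies the
    conclusion trivially. *)
Lemma concentration_on_seq (d : measure_display) (T : measurableType d)
    (R : realType) (P : probability T R) (m n p : nat)
    (A : T -> {linear 'M[R]_(m, n) -> 'cV[R]_p}) (N : seq 'M[R]_(m, n))
    (delta : R)
    (q := 2 * expR (- (p%:R / 2 * (delta ^+ 2 / 2 - delta ^+ 3 / 3)))) :
  0 < delta < 1 -> random_linear_map A -> nearly_isometric P A ->
  exists B : set T, [/\ measurable B, (P B <= ((size N)%:R * q)%:E)%E &
    forall w, ~ B w -> forall X, X \in N ->
      `|fnorm (A w X) ^+ 2 - fnorm X ^+ 2| <= delta * fnorm X ^+ 2].
Proof.
move=> hdelta mA [_ conc _]; have q0 : 0 <= q by rewrite mulr_ge0 ?expR_ge0.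
elim: N => [|X N [B [mB PB hB]]].
  by exists set0; split => //; rewrite ?measure0 ?mul0r.
have [X0|X0] := eqVneq X 0.
  exists B; split => //.
    by apply: le_trans PB _; rewrite lee_fin ler_wpM2r // ler_nat.
  move=> w /hB hw Y; rewrite inE => /orP[/eqP->|]; last exact: hw.
  by rewrite X0 linear0 !fnorm0 expr0n /= subrr normr0 mulr0.
pose f w := `|fnorm (A w X) ^+ 2 - fnorm X ^+ 2|.
pose C := [set w | delta * fnorm X ^+ 2 <= f w].
have mC : measurable C.
  rewrite (_ : C = [set: T] `&` f @^-1` [set` `[delta * fnorm X ^+ 2, +oo[]).
    have mf : measurable_fun setT f.
      apply: measurableT_comp => //.
      apply: measurable_realfun.measurable_funB => //.
      exact: measurable_fnorm_sqr.
    by apply: mf => //; exact: measurable_itv.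
  by rewrite setTI; apply/seteqP; split => w /=; rewrite in_itv /= andbT.
exists (C `|` B); split; first exact: measurableU.
  apply: le_trans (measureU2 _ _ _) _ => //.
  rewrite /= -nat1r mulrDl mul1r EFinD; apply: leeD => //.
  exact: conc.
move=> w /not_orP[nC nB] Y; rewrite inE => /orP[/eqP->|YN]; last exact: hB.
by rewrite leNgt; apply/negP => /ltW.
Qed.

(** * Numerical bounds on the parameters and on the size of the net *)

Lemma incoherence_parameters (R : realType) (m n r s : nat) (mu : R)
    (g := mu ^+ 2 * (r%:R ^+ 2 * s%:R / (m%:R * n%:R)))
    (tau := (1 - g) `^ (- (1 / 2))) (x := tau * (m%:R * n%:R / s%:R)) :
  (0 < r)%N -> (0 < s)%N -> 1 <= mu ->
  mu < Num.sqrt (m%:R * n%:R) / (r%:R * Num.sqrt s%:R) ->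
  [/\ (0 < m)%N /\ (0 < n)%N, (s <= m * n)%N,
      1 <= tau /\ tau ^+ 2 * (1 - g) = 1,
      Num.sqrt r%:R * tau <= x /\ m%:R * n%:R / s%:R <= x & 2 <= x].
Proof.
move=> r0 s0 mu1 hmu.
have r1 : 1 <= r%:R :> R by rewrite ler1n.
have s1 : 1 <= s%:R :> R by rewrite ler1n.
have ss1 : 0 < Num.sqrt s%:R :> R by rewrite sqrtr_gt0; lra.
have rs0 : 0 < r%:R * Num.sqrt s%:R :> R by rewrite mulr_gt0 // ltr0n.
rewrite ltr_pdivlMr // in hmu.
have mrs0 : 0 < mu * (r%:R * Num.sqrt s%:R) by rewrite mulr_gt0 //; lra.
have mn0 : 0 < m%:R * n%:R :> R by rewrite -sqrtr_gt0; exact: lt_trans hmu.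
(* Squaring the hypothesis on mu yields g < 1. As mu >= 1, it also yields r^2 s <= mn, hence s <= mn
   and sqrt(r) <= r^2 <= mn / s. *)
have hsq : mu ^+ 2 * (r%:R ^+ 2 * s%:R) < m%:R * n%:R.
  have := hmu; rewrite -ltr_sqr ?nnegrE ?sqrtr_ge0 ?(ltW mrs0) // !exprMn.
  by rewrite !sqr_sqrtr ?(ltW mn0) ?ler0n.
have mu21 : 1 <= mu ^+ 2 by rewrite exprn_ege1.
have r21 : 1 <= r%:R ^+ 2 :> R by rewrite exprn_ege1.
have r2s : r%:R ^+ 2 * s%:R <= m%:R * n%:R :> R.
  have : 0 <= r%:R ^+ 2 * s%:R :> R by rewrite mulr_ge0 ?sqr_ge0.
  by nra.
have g1 : g < 1 by rewrite /g mulrA ltr_pdivrMr // mul1r.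
have g0 : 0 < g.
  apply: mulr_gt0; first by lra.
  by apply: divr_gt0 => //; apply: mulr_gt0; lra.
pose w := Num.sqrt (1 - g).
have w0 : 0 < w by rewrite sqrtr_gt0 subr_gt0.
have w2 : w ^+ 2 = 1 - g by rewrite sqr_sqrtr // subr_ge0 ltW.
have w1 : w <= 1 by rewrite -ler_sqr ?nnegrE ?(ltW w0) //; lra.
have tauE : tau = w^-1 by rewrite /tau powRN div1r powR12_sqrt // subr_ge0 ltW.
have tau1 : 1 <= tau by rewrite tauE invf_ge1.
have r2mns : r%:R ^+ 2 <= m%:R * n%:R / s%:R :> R by rewrite ler_pdivlMr //; lra.
have sr : Num.sqrt r%:R <= r%:R ^+ 2 :> R.
  apply: le_trans (_ : r%:R <= _); last by nra.
  by rewrite -ler_sqr ?nnegrE ?sqrtr_ge0 // sqr_sqrtr //; nra.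
split.
- by have := mn0; rewrite -natrM ltr0n muln_gt0 => /andP.
- by rewrite -(ler_nat R) natrM; apply: le_trans r2s; nra.
- by split => //; rewrite -w2 tauE -exprMn mulVf ?expr1n // gt_eqF.
- split; last by rewrite ler_peMl // divr_ge0 // ltW.
  by rewrite mulrC; apply: ler_wpM2l; [lra|exact: le_trans r2mns].
(* Since mn / s = mu^2 r^2 / g >= 1 / g and tau = 1 / w, it is enough that w g <= 1/2. Now w g is
   the product of w (1 - w) <= 1/4 and 1 + w <= 2. *)
apply: le_trans (_ : tau * g^-1 <= _).
  rewrite tauE -invfM -[2]invrK lef_pV2 ?posrE ?(mulr_gt0 w0 g0) ?invr_gt0 ?ltr0n //.
  have gw : g = (1 - w) * (1 + w) by rewrite -subr_sqr w2; ring.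
  have h : w * (1 - w) <= 4^-1 by have := sqr_ge0 (w - 2^-1); nra.
  rewrite gw mulrA.
  by apply: le_trans (ler_wpM2r _ h) _; lra.
rewrite /x; apply: ler_wpM2l; first by lra.
have smn0 : 0 < s%:R / (m%:R * n%:R) :> R by rewrite divr_gt0 //; lra.
rewrite -invf_div lef_pV2 ?posrE //.
have -> : g = mu ^+ 2 * r%:R ^+ 2 * (s%:R / (m%:R * n%:R)) by rewrite /g !mulrA.
by rewrite ler_peMl ?(ltW smn0) // mulr_ege1.
Qed.

(** With x = e^l and l >= 1/2, every factor becomes an exponential: the binomial coefficient is at
    most e^(D(1 + l)), the base of the power at most e^(kappa + l), and its exponent at most 2D
    because 2r <= m + n. The factor 2 comes from the two-sided tail bound and is absorbed by e. *)
Lemma cover_size_bound (R : realType) (m n r s k : nat) (tau eps x : R)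
    (kappa := ln (2 * expR 1 * (eps^-1 + 1)))
    (D := r%:R * (m%:R + n%:R - r%:R) + s%:R) :
  (r <= m)%N -> (r <= n)%N -> (0 < r)%N -> (0 < s)%N -> 0 < eps -> 1 <= tau ->
  Num.sqrt r%:R * tau <= x -> m%:R * n%:R / s%:R <= x -> 2 <= x ->
  k%:R <= 'C(m * n, s)%:R
      * (2 * expR 1 * (Num.sqrt r%:R * tau / eps + 1)) ^+ (m * r + r * n + s) ->
  k%:R * 2 <= expR ((7 + 4 * kappa) * (D * ln x)).
Proof.
move=> rm rn r0 s0 eps0 tau1 rtx mnx x2 hk.
have e1 : 2 <= expR 1 :> R by have := @expR_ge1Dx R 1; lra.
have eV : 0 < eps^-1 by rewrite invr_gt0.
have C1 : 1 <= 2 * expR 1 * (eps^-1 + 1) by nra.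
have C0 := lt_le_trans ltr01 C1.
have kappa0 : 0 <= kappa by exact: ln_ge0.
have x0 : 0 < x by lra.
set l := ln x.
have xE : x = expR l by rewrite lnK // posrE.
have l2 : 2^-1 <= l.
  rewrite -ler_expR -xE; apply: le_trans x2.
  rewrite -[2^-1]opprK expRN -[leRHS]invrK lef_pV2 ?posrE ?expR_gt0 //.
  by have := @expR_ge1Dx R (- 2^-1); lra.
have rm' : r%:R <= m%:R :> R by rewrite ler_nat.
have rn' : r%:R <= n%:R :> R by rewrite ler_nat.
have r1 : 1 <= r%:R :> R by rewrite ler1n.
have s1 : 1 <= s%:R :> R by rewrite ler1n.
have D1 : 1 <= D by rewrite /D; nra.
have sD : s%:R <= D by rewrite /D; nra.
have MD : (m * r + r * n + s)%:R <= 2 * D by rewrite /D !natrD !natrM; nra.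
have base : 2 * expR 1 * (Num.sqrt r%:R * tau / eps + 1) <= expR (kappa + l).
  rewrite expRD -xE lnK ?posrE //.
  have : Num.sqrt r%:R * tau / eps <= x / eps by rewrite ler_pM2r.
  by move: (Num.sqrt r%:R * tau / eps) => y; nra.
have base0 : 0 <= 2 * expR 1 * (Num.sqrt r%:R * tau / eps + 1).
  by rewrite !mulr_ge0 ?expR_ge0 // addr_ge0 // !mulr_ge0 ?sqrtr_ge0 //; lra.
have baseM :
    (2 * expR 1 * (Num.sqrt r%:R * tau / eps + 1)) ^+ (m * r + r * n + s)
    <= expR (2 * D * (kappa + l)).
  apply: le_trans (_ : expR (kappa + l) ^+ (m * r + r * n + s) <= _).
    by rewrite lerXn2r // nnegrE ?expR_ge0.
  rewrite -expRM_natl ler_expR ler_wpM2r //; lra.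
have binM : 'C(m * n, s)%:R <= expR (D * (1 + l)).
  apply: le_trans (binomial_le _ _ s0) _.
  apply: le_trans (_ : expR (1 + l) ^+ s <= _).
    rewrite lerXn2r // ?nnegrE ?expR_ge0 ?divr_ge0 ?mulr_ge0 ?expR_ge0 //.
    by rewrite expRD -xE natrM -mulrA ler_wpM2l ?expR_ge0.
  by rewrite -expRM_natl ler_expR ler_wpM2r //; lra.
apply: le_trans
  (_ : expR (D * (1 + l)) * expR (2 * D * (kappa + l)) * expR 1 <= _).
  apply: ler_pM => //; apply: le_trans hk _.
  by apply: ler_pM => //; exact: exprn_ge0.
rewrite -!expRD ler_expR.
(* As l >= 1/2, the terms without l are bounded by multiples of D l: D and 1 cost 2 each, 2 D kappa
   costs 4 kappa, and with the 3 D l already present the total is 7 + 4 kappa. *)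
have Dl : 1 <= 2 * (D * l) by nra.
have Dk : D * kappa <= 2 * kappa * (D * l).
  have kD : 0 <= kappa * D by rewrite mulr_ge0 //; lra.
  by have : kappa * D * 2^-1 <= kappa * D * l by [rewrite ler_wpM2l]; lra.
have D2 : D <= 2 * (D * l) by nra.
have -> : (7 + 4 * kappa) * (D * l) = 7 * (D * l) + 2 * (2 * kappa * (D * l)).
  by ring.
by have -> : 2 * D * (kappa + l) = 2 * (D * kappa) + 2 * (D * l); [ring|lra].
Qed.

(** * Assembly of the probability bound *)

Lemma LS_rip_of_cover (R : realType) (m n p r s : nat) (mu Delta : R)
    (A : {linear 'M[R]_(m, n) -> 'cV[R]_p}) (N : seq 'M[R]_(m, n)) (tau : R)
    (g := mu ^+ 2 * (r%:R ^+ 2 * s%:R / (m%:R * n%:R))) :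
  0 < Delta < 1 -> 0 <= mu -> 1 <= tau -> tau ^+ 2 * (1 - g) = 1 ->
  lowrank_sparse_cover r s tau (Delta / 96) N ->
  (forall X', X' \in N ->
    `|fnorm (A X') ^+ 2 - fnorm X' ^+ 2| <= Delta / 2 * fnorm X' ^+ 2) ->
  rip_on (LS r s mu) Delta A.
Proof.
move=> hDelta mu0 tau1 tauE cov iso X /(LS_decomposition mu0).
rewrite -/g => -[L [S [-> rL sS nL nS]]].
have le_tau (Y : 'M[R]_(m, n)) : (1 - g) * fnorm Y ^+ 2 <= fnorm (L + S) ^+ 2 ->
    fnorm Y <= tau * fnorm (L + S).
  move=> h; rewrite -ler_sqr ?nnegrE ?mulr_ge0 ?fnorm_ge0 //; last by lra.
  rewrite exprMn; apply: le_trans (ler_wpM2l (sqr_ge0 tau) h).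
  by rewrite mulrA tauE mul1r.
exact: (rip_of_cover hDelta tau1 cov iso rL sS (le_tau L nL) (le_tau S nS)).
Qed.

Theorem theorem1 (R : realType) (Delta : R) (hDelta : 0 < Delta < 1) :
  exists c0 c1 : R, [/\ 0 < c0, 0 < c1 &
    forall (m n p r s : nat) (mu : R)
           (d : measure_display) (T : measurableType d) (P : probability T R)
           (A : T -> {linear 'M[R]_(m, n) -> 'cV[R]_p}),
      (0 < r)%N -> (0 < s)%N -> 1 <= mu ->
      mu < Num.sqrt (m%:R * n%:R) / (r%:R * Num.sqrt s%:R) ->
      random_linear_map A ->
      nearly_isometric P A ->
      c0 * (r%:R * (m%:R + n%:R - r%:R) + s%:R)
         * ln ((1 - mu ^+ 2 * (r%:R ^+ 2 * s%:R / (m%:R * n%:R))) `^ (- (1 / 2))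
               * (m%:R * n%:R / s%:R)) < p%:R ->
      ((1 - expR (- (c1 * p%:R)))%:E
         <= P [set w | (ric r s mu (A w) <= Delta)%R])%E].
Proof.
have [D0 D1] := andP hDelta.
pose delta := Delta / 2; pose eps := Delta / 96.
have hdelta : 0 < delta < 1 by rewrite /delta; apply/andP; split; lra.
have eps0 : 0 < eps by rewrite /eps; lra.
(* The tail bound at deviation [delta] is 2 exp(-a p). *)
pose a := (delta ^+ 2 / 2 - delta ^+ 3 / 3) / 2.
have a0 : 0 < a by rewrite /a; case/andP: hdelta; nra.
pose kappa := ln (2 * expR 1 * (eps^-1 + 1)).
have kappa0 : 0 <= kappa.
  apply: ln_ge0; have := @expR_ge1Dx R 1; have : 0 < eps^-1 by rewrite invr_gt0.
  by nra.
(* With this c0 the logarithm of twice the net size is at most a p / 2, half of the tail exponent;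
   the other half is left as c1 p. *)
exists (2 * (7 + 4 * kappa) / a), (a / 2); split.
- by rewrite divr_gt0 // mulr_gt0 //; lra.
- by lra.
move=> m n p r s mu d T P A r0 s0 mu1 hmu mA hA hp.
have -> : [set w | ric r s mu (A w) <= Delta]
          = [set w | rip_on (LS r s mu) Delta (A w)].
  by apply/seteqP; split => w /ric_leP; apply.
have mrip : measurable [set w | rip_on (LS r s mu) Delta (A w)].
  by apply: measurable_rip_on => //; apply/andP; split; lra.
(* If r exceeds m or n, there are no first r singular vectors, so [LS] is empty and the event is
   certain. *)
have [[rm rn]|nrmn] := pselect ((r <= m)%N /\ (r <= n)%N); last first.
  rewrite (_ : [set w | _] = setT).
    by rewrite probability_setT lee_fin gerBl expR_ge0.
  apply/seteqP; split => // w _ X [L [S [_ _ _ [U [V]]]]].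
  by case=> -[rm [rn _]]; case: nrmn.
have [[m0 n0] smn [tau1 tauE] [rtx mnx] x2] :=
  incoherence_parameters r0 s0 mu1 hmu.
move: tau1 tauE rtx mnx x2 hp; set tau := _ `^ _; set x := tau * _.
move=> tau1 tauE rtx mnx x2 hp.
have [||N sizeN covN] :=
  @lowrank_sparse_net R m n r s tau eps m0 n0 r0 _ _ eps0.
- by rewrite s0.
- by lra.
have size2 :=
  cover_size_bound rm rn r0 s0 eps0 tau1 rtx mnx x2 sizeN.
have [B [mB PB hB]] := concentration_on_seq N hdelta mA hA.
have PB' : (P B <= (expR (- (a / 2 * p%:R)))%:E)%E.
  apply: le_trans PB _; rewrite lee_fin mulrA.
  apply: le_trans (ler_wpM2r (expR_ge0 _) size2) _.
  rewrite -expRD ler_expR -/kappa.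
  move: hp; rewrite -mulrA mulrAC ltr_pdivrMr // => hp.
  have -> : p%:R / 2 * (delta ^+ 2 / 2 - delta ^+ 3 / 3) = p%:R * a.
    by rewrite /a; field.
  by lra.
apply: (@le_trans _ _ (P (~` B))).
  rewrite probability_setC // EFinB; apply: leeB => //.
apply: le_measure; rewrite ?inE //; first exact: measurableC.
move=> w nB; apply: (LS_rip_of_cover hDelta _ tau1 tauE covN); first by lra.
exact: hB.
Qed.
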